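(* Let $(X_i)_{i\in\mathbb{N}}$ be a sequence of free identically distributed self-adjoint random variables with distribution $\mu$ for some probability measure $\mu$ on $\mathbb{R}$. Assume that $\mu$ has mean zero, unit variance, and finite sixth moment. For $\theta\in\mathbb{S}^{n-1}$ denote by $\mu_\theta$ the distribution of $S_\theta=\theta_1X_1+\dots+\theta_nX_n$. Let $\rho\in(0,1)$. Then there exist constants $n_{\rho,\mu}\in\mathbb{N}$ and $C_{\rho,\mu}>0$ (not depending on $n$), parameters $a=a_n\in(0,1)$ and $\varepsilon=\varepsilon_n\ge0$ for $n\ge n_{\rho,\mu}$ (depending on $n,\rho,\mu$ but not on $\theta$), and, for each $n$, a measurable set $\mathcal{F}=\mathcal{F}_n\subset\mathbb{S}^{n-1}$ with $\sigma_{n-1}(\mathcal{F})\ge1-\rho$ such that for all $n\ge n_{\rho,\mu}$ and all $\theta\in\mathcal{F}$ the quantity $$\tilde\Delta(\mu_\theta,\omega)=\sup_{u\in[-2+\varepsilon/2,\,2-\varepsilon/2]}\int_a^1|G_\theta(u+iv)-G_\omega(u+iv)|\,dv+a+\varepsilon^{3/2}$$ satisfies $$\tilde\Delta(\mu_\theta,\omega)\le C_{\rho,\mu}\frac{\sqrt{\log n}}{n^{3/4}}.$$ The constant $C_{\rho,\mu}$ depends on $\rho$ and on $\mu$ through its first six absolute moments.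
   Context: For a probability measure $\nu$ on $\mathbb{R}$, $G_\nu(z)=\int_{\mathbb{R}}\frac{1}{z-t}\nu(dt)$, $z\in\mathbb{C}^+$, is its Cauchy transform; $G_\theta=G_{\mu_\theta}$, and $G_\omega$ is the Cauchy transform of $\omega$. $\mathbb{S}^{n-1}$ is the unit sphere of $\mathbb{R}^n$ and $\sigma_{n-1}$ is the uniform probability measure on it. $\omega$ is Wigner's semicircle law with mean zero and variance one, i.e. the measure with density $\frac{1}{2\pi}\sqrt{4-x^2}$ on $[-2,2]$. The $X_i$ are (possibly unbounded) self-adjoint random variables in a tracial noncommutative probability space, free in Voiculescu's sense. The distribution of $S_\theta$ is the free additive convolution $\mu_\theta=\mu_1\boxplus\dots\boxplus\mu_n$, where $\mu_i=D_{\theta_i}\mu$ is the push-forward of $\mu$ under $x\mapsto\theta_i x$. Analytically, with $F_\nu=1/G_\nu$ on the upper half-plane $\mathbb{C}^+$, the measure $\nu=\nu_1\boxplus\dots\boxplus\nu_n$ is the probability measure with $F_\nu(z)=F_{\nu_1}(Z_1(z))$, where $Z_1,\dots,Z_n:\mathbb{C}^+\to\mathbb{C}^+$ are the unique holomorphic functions with $Z_1(z)+\dots+Z_n(z)-z=(n-1)F_{\nu_1}(Z_1(z))$ and $F_{\nu_1}(Z_1(z))=\dots=F_{\nu_n}(Z_n(z))$ for all $z\in\mathbb{C}^+$. *)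

(* Defs.v *)
From HB Require Import structures.
From mathcomp Require Import all_boot all_order all_algebra.
From mathcomp Require Import all_classical all_reals all_analysis.
From mathcomp Require Import measurable_realfun.
From mathcomp Require Export complex.

Set Implicit Arguments.
Unset Strict Implicit.
Unset Printing Implicit Defensive.

Import Order.TTheory GRing.Theory Num.Theory.
Import numFieldNormedType.Exports.

Local Open Scope classical_set_scope.
Local Open Scope ring_scope.
Local Open Scope complex_scope.

Section cauchy_transform.
Context {R : realType}.

Definition upper_half_plane : set R[i] := [set z | 0 < complex.Im z].

(* [derivable f z 1] over the base field R[i] itself is complex
   differentiability at z: the increment h ranges over R[i]. *)
Definition holomorphic_on (D : set R[i]) (f : R[i] -> R[i]) : Prop :=
  forall z, D z -> derivable (f : R[i]^o -> R[i]^o) z 1.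

(* The complex integral of 1 / (z - t), taken on real and imaginary parts. *)
Definition cauchy_transform (nu : {measure set R -> \bar R}) (z : R[i]) : R[i] :=
  (\int[nu]_t complex.Re (z - t%:C)^-1) +i*
  (\int[nu]_t complex.Im (z - t%:C)^-1).

Definition recip_cauchy (nu : {measure set R -> \bar R}) (z : R[i]) : R[i] :=
  (cauchy_transform nu z)^-1.

(* nu = nu_1 [+] ... [+] nu_n, through the subordination functions Z_i, which
   exist and are unique for n >= 1. All the F_{nu_i}(Z_i(z)) are equal, so the
   last two conditions may be stated for every i rather than for one chosen i. *)
Definition is_free_convolution (n : nat) (nus : 'I_n -> probability R R)
    (nu : probability R R) : Prop :=
  exists Z : 'I_n -> R[i] -> R[i],
    [/\ (forall i, holomorphic_on upper_half_plane (Z i)),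
        (forall i z, upper_half_plane z -> upper_half_plane (Z i z)),
        (forall i j z, upper_half_plane z ->
           recip_cauchy (nus i) (Z i z) = recip_cauchy (nus j) (Z j z)),
        (forall i z, upper_half_plane z ->
           recip_cauchy nu z = recip_cauchy (nus i) (Z i z)) &
        (forall i z, upper_half_plane z ->
           \sum_(j < n) Z j z - z = n.-1%:R * recip_cauchy (nus i) (Z i z))].

End cauchy_transform.

Section dilation.
Context {R : realType}.

Definition scale_by (c x : R) : R := c * x.

Let measurable_scale_by c : measurable_fun [set: R] (scale_by c).
Proof. exact: mulrl_measurable. Qed.

HB.instance Definition _ c :=
  isMeasurableFun.Build _ _ _ _ (scale_by c) (measurable_scale_by c).

Definition dilation (c : R) (mu : probability R R) : probability R R :=
  distribution mu (scale_by c).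

End dilation.

Section semicircle.
Context {R : realType}.

(* [Num.sqrt] vanishes on negative reals, hence so does this density outside
   [-2, 2]. *)
Definition semicircle_pdf (x : R) : R := (2 * pi)^-1 * Num.sqrt (4 - x ^+ 2).

Definition semicircle (A : set R) : \bar R :=
  (\int[lebesgue_measure]_(x in A) (semicircle_pdf x)%:E)%E.

Let semicircle_pdf_ge0 x : 0 <= semicircle_pdf x.
Proof. by rewrite mulr_ge0 ?sqrtr_ge0// invr_ge0 mulr_ge0// pi_ge0. Qed.

Let measurable_semicircle_pdf : measurable_fun [set: R] semicircle_pdf.
Proof.
apply: measurable_funM => //; apply: continuous_measurable_fun => x.
apply: (@continuous_comp _ _ _ (fun x : R => 4 - x ^+ 2) Num.sqrt);
  last exact: sqrt_continuous.
by apply: cvgB; [exact: cvg_cst | exact: exprn_continuous].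
Qed.

Let semicircle0 : semicircle set0 = 0%E.
Proof. by rewrite /semicircle integral_set0. Qed.

Let semicircle_ge0 A : (0 <= semicircle A)%E.
Proof. by apply: integral_ge0 => x _; rewrite lee_fin. Qed.

Let semicircle_sigma_additive : semi_sigma_additive semicircle.
Proof.
apply: (@semi_sigma_additive_nng_induced _ _ _ lebesgue_measure
  (EFin \o semicircle_pdf)).
  exact/measurable_EFinP.
by move=> x; rewrite lee_fin.
Qed.

HB.instance Definition _ := isMeasure.Build _ _ _ semicircle
  semicircle0 semicircle_ge0 semicircle_sigma_additive.

End semicircle.

Section sphere.
Context {R : realType}.

(* Euclidean unit sphere. Vectors are tuples because n.-tuple R carries the
   product (= Borel) sigma-algebra. *)
Definition unit_sphere (n : nat) : set (n.-tuple R) :=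
  [set x | \sum_(i < n) tnth x i ^+ 2 = 1].
Arguments unit_sphere n x : clear implicits.

Definition mx_act (n : nat) (M : 'M[R]_n) (x : n.-tuple R) : n.-tuple R :=
  [tuple \sum_(j < n) M i j * tnth x j | i < n].

(* The uniform probability measure on the sphere is the only rotation-invariant
   Borel probability measure carried by it; it exists for all n >= 1. *)
Definition is_uniform_on_sphere (n : nat)
    (sigma : probability (n.-tuple R) R) : Prop :=
  sigma (unit_sphere n) = 1%E /\
  forall (M : 'M[R]_n), M *m M^T = 1%:M ->
  forall A : set (n.-tuple R), measurable A ->
    sigma (mx_act M @^-1` A) = sigma A.

End sphere.

Arguments unit_sphere {R} n x.

Section statement_notions.
Context {R : realType}.

Definition abs_moment (mu : probability R R) (k : nat) : \bar R :=
  ('E_mu[fun x : R => (`|x| ^+ k)%R])%E.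

(* The supremum is taken in \bar R, so it is -oo when 4 < eps, the range of u
   being empty in that case. *)
Definition Delta_tilde (a eps : R) (nu nu' : {measure set R -> \bar R}) : \bar R :=
  (ereal_sup
     [set \int[lebesgue_measure]_(v in `[a, 1%R])
            (Normc.normc (cauchy_transform nu (u +i* v)
                          - cauchy_transform nu' (u +i* v)))%:E
     | u in `[(- 2 + eps / 2)%R, (2 - eps / 2)%R]]
   + a%:E + (eps `^ (3 / 2))%:E)%E.

End statement_notions.

(* Main.v *)
From HB Require Import structures.
Require Import Defs.
From mathcomp Require Import all_boot all_order all_algebra.
From mathcomp Require Import all_classical all_reals all_analysis.
From mathcomp Require Import measurable_realfun.
From mathcomp Require Import ring lra.

Set Implicit Arguments.
Unset Strict Implicit.
Unset Printing Implicit Defensive.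

Import Order.TTheory GRing.Theory Num.Theory.
Import numFieldNormedType.Exports.
Import Normc.

Local Open Scope classical_set_scope.
Local Open Scope ring_scope.
Local Open Scope complex_scope.

(** Why the theorem holds. Fix a point $z = u + iv$ and write $F = 1/G_\theta(z)$
    and $d_i = Z_i(z) - F$. The subordination system says that the numbers
    $Z_i(z)$ satisfy $F = F_{\mu_i}(Z_i(z))$ and $\sum_i d_i = z - F$, and these
    equations at the single point $z$ already determine $G_\theta(z)$ closely
    enough.

    One summand: with $f(t) = 1/(w - \theta t)$ and $w = Z_i(z)$, the variance
    $X$ of $F f$ under $\mu$ measures how much $F_{\mu_i}$ raises the imaginary
    part, $\Im F = (1 + X)\,\Im w$ [Im_recip]. Cauchy-Schwarz bounds $X$ from
    both sides: $|d_i|^2 \le \theta^2 X$ [sqr_displacement_le], and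
    $\theta^2 \le X\,(2|w|^2 + O(\theta^2))$ [excess_lower_bound]. Taking
    imaginary parts in $\sum_i d_i = z - F$, the second bound prevents all the
    $Z_i$ from being small [subordination_large]; the first one, when
    $\theta_i^2 \le v/16$, keeps all of them close to $F$. Hence $|F|$ and all
    $|Z_i|$ are bounded below, and the expansion of $G_{\mu_i}$ in the six
    moments of $\mu$ gives
    $d_i = \theta_i^2 G + \theta_i^3 m_3 G^2 + O(\theta_i^4)$
    [displacement_expansion]. Summation gives $G + 1/G = z + O(1/n)$ as soon as
    $|\sum\theta_i^3|$ and $\sum\theta_i^4$ are $O(1/n)$
    [approximate_quadratic_equation].

    The semicircle law: $g = G_\omega(z)$ satisfies $g + 1/g = z$ exactly
    [semicircle_cauchy_transform]. Both $G$ and $g$ lie in the lower half-plane,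
    where $G \mapsto G + 1/G$ is injective with modulus of continuity
    controlled by $1/|\Im g|$, and $|\Im g| \ge \sqrt\varepsilon/32$ for
    $|u| \le 2 - \varepsilon/2$ [semicircle_stability,
    semicircle_Im_lower_bound]. With
    $\varepsilon = n^{-1/2}$ the difference $|G - g|$ is $O(n^{-3/4})$,
    uniformly down to height $v = a$ of order $n^{-3/4}$.

    Good directions: on the sphere the means of $\sum\theta_i^4$,
    $(\sum\theta_i^3)^2$ and $\sum\theta_i^8$ are at most of order $n^{-1}$,
    $n^{-2}$ and $n^{-3}$. This follows from the invariance under reflections of
    coordinate planes [sphere_moment_step, sphere_cube_sum_sqr], and Markov's
    inequality turns it into bounds valid with probability $1 - \rho$
    [good_set_probability, good_set_bounds]. The eighth powers give
    $\max_i\theta_i^2 = O(n^{-3/4})$, which is the order of $a$. *)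

Local Notation Re := complex.Re.
Local Notation Im := complex.Im.

(** * Norm, real and imaginary parts of complex numbers *)

Section normc_theory.
Context {R : realType}.
Implicit Types (x y z : R[i]) (a : R).

Lemma sqr_normcE z : normc z ^+ 2 = Re z ^+ 2 + Im z ^+ 2.
Proof. by case: z => a b /=; rewrite sqr_sqrtr// addr_ge0 ?sqr_ge0. Qed.

Lemma normc_ge0 z : 0 <= normc z.
Proof. by case: z => a b; exact: sqrtr_ge0. Qed.

Lemma normc_gt0 z : (0 < normc z) = (z != 0).
Proof.
rewrite lt_def normc_ge0 andbT; congr (~~ _); apply/eqP/eqP => [|->].
  exact: eq0_normc.
exact: normc0.
Qed.

Lemma normcR a : normc a%:C = `|a|.
Proof. by rewrite /normc /= expr0n addr0 sqrtr_sqr. Qed.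

Lemma normcX z n : normc (z ^+ n) = normc z ^+ n.
Proof. by elim: n => [|n IH]; rewrite ?expr0 ?normc1// !exprS normcM IH. Qed.

Lemma normcBC x y : normc (x - y) = normc (y - x).
Proof. by rewrite -normcN opprB. Qed.

Lemma le_normcB x y : normc (x - y) <= normc x + normc y.
Proof. by rewrite -(normcN y); exact: le_normcD. Qed.

Lemma ger_normcB x y : normc x - normc y <= normc (x - y).
Proof. by rewrite lerBlDr -[in leLHS](subrK y x); exact: le_normcD. Qed.

Lemma normRe_le z : `|Re z| <= normc z.
Proof.
rewrite -(@ler_pXn2r _ 2) ?nnegrE ?normc_ge0// real_normK ?num_real//.
by rewrite sqr_normcE lerDl sqr_ge0.
Qed.

Lemma normIm_le z : `|Im z| <= normc z.
Proof.
rewrite -(@ler_pXn2r _ 2) ?nnegrE ?normc_ge0// real_normK ?num_real//.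
by rewrite sqr_normcE lerDr sqr_ge0.
Qed.

Lemma normc_leReIm z : normc z <= `|Re z| + `|Im z|.
Proof.
rewrite -(@ler_pXn2r _ 2) ?nnegrE ?normc_ge0// ?addr_ge0//.
rewrite sqr_normcE sqrrD !real_normK ?num_real//.
have : 0 <= `|Re z| * `|Im z| by rewrite mulr_ge0.
by move=> h; lra.
Qed.

Lemma le_normc_sum (I : Type) (s : seq I) (F : I -> R[i]) :
  normc (\sum_(i <- s) F i) <= \sum_(i <- s) normc (F i).
Proof.
elim: s => [|i s IH]; first by rewrite !big_nil normc0.
by rewrite !big_cons (le_trans (le_normcD _ _))// lerD2l.
Qed.

Lemma cReD x y : Re (x + y) = Re x + Re y. Proof. by case: x; case: y. Qed.
Lemma cImD x y : Im (x + y) = Im x + Im y. Proof. by case: x; case: y. Qed.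
Lemma cReN x : Re (- x) = - Re x. Proof. by case: x. Qed.
Lemma cImN x : Im (- x) = - Im x. Proof. by case: x. Qed.
Lemma cReM x y : Re (x * y) = Re x * Re y - Im x * Im y.
Proof. by case: x; case: y. Qed.
Lemma cImM x y : Im (x * y) = Re x * Im y + Im x * Re y.
Proof. by case: x; case: y. Qed.
Lemma cReV x : Re x^-1 = Re x / normc x ^+ 2.
Proof. by rewrite sqr_normcE; case: x. Qed.
Lemma cImV x : Im x^-1 = - (Im x / normc x ^+ 2).
Proof. by rewrite sqr_normcE; case: x. Qed.

Lemma cIm_sum (I : Type) (s : seq I) (F : I -> R[i]) :
  Im (\sum_(i <- s) F i) = \sum_(i <- s) Im (F i).
Proof.
by elim: s => [|i s IH]; rewrite ?big_nil// !big_cons cImD IH.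
Qed.

Lemma neq0_Im z : 0 < Im z -> z != 0.
Proof. by case: z => a b /= b0; rewrite eq_complex /= negb_and (gt_eqF b0) orbT. Qed.

Lemma complex_eqP x y : Re x = Re y -> Im x = Im y -> x = y.
Proof. by case: x => a b; case: y => c d /= -> ->. Qed.

End normc_theory.

(** * Integrals of complex-valued functions *)

Section complex_integral.
Context d (T : measurableType d) {R : realType}.
Variables (m : {measure set T -> \bar R}) (D : set T).
Hypothesis mD : measurable D.
Implicit Types (f g : T -> R[i]) (c : R[i]).

Definition Cintegrable f :=
  m.-integrable D (EFin \o (fun t => Re (f t))) /\
  m.-integrable D (EFin \o (fun t => Im (f t))).

Definition Cintegral f : R[i] :=
  (\int[m]_(t in D) Re (f t)) +i* (\int[m]_(t in D) Im (f t)).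

Let intD (f g : T -> R) : m.-integrable D (EFin \o f) ->
  m.-integrable D (EFin \o g) -> m.-integrable D (EFin \o (fun t => f t + g t)).
Proof.
move=> fi gi; have := integrableD mD fi gi; apply: eq_integrable => //.
Qed.

Let intZ (k : R) (f : T -> R) : m.-integrable D (EFin \o f) ->
  m.-integrable D (EFin \o (fun t => k * f t)).
Proof. by move=> fi; have := integrableZl mD k fi; exact: eq_integrable. Qed.

Lemma CintegrableD f g : Cintegrable f -> Cintegrable g ->
  Cintegrable (fun t => f t + g t).
Proof.
move=> [fr fi] [gr gi]; split.
  by have := intD fr gr; apply: eq_integrable => // t _ /=; rewrite cReD.
by have := intD fi gi; apply: eq_integrable => // t _ /=; rewrite cImD.
Qed.

Lemma CintegrableZ c f : Cintegrable f -> Cintegrable (fun t => c * f t).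
Proof.
move=> [fr fi]; split.
  have := intD (intZ (Re c) fr) (intZ (- Im c) fi).
  by apply: eq_integrable => // t _ /=; rewrite cReM mulNr.
have := intD (intZ (Re c) fi) (intZ (Im c) fr).
by apply: eq_integrable => // t _ /=; rewrite cImM.
Qed.

Lemma CintegralD f g : Cintegrable f -> Cintegrable g ->
  Cintegral (fun t => f t + g t) = Cintegral f + Cintegral g.
Proof.
move=> [fr fi] [gr gi]; rewrite /Cintegral; apply: complex_eqP => /=.
  by rewrite -RintegralD//; apply: eq_Rintegral => t _; rewrite cReD.
by rewrite -RintegralD//; apply: eq_Rintegral => t _; rewrite cImD.
Qed.

Lemma CintegralZ c f : Cintegrable f ->
  Cintegral (fun t => c * f t) = c * Cintegral f.
Proof.
move=> [fr fi]; rewrite /Cintegral; apply: complex_eqP; rewrite ?cReM ?cImM /=.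
  rewrite -RintegralZl// -[X in _ = _ - X]RintegralZl// -RintegralB//; [|exact: intZ..].
  by apply: eq_Rintegral => t _; rewrite cReM.
rewrite -RintegralZl// -[X in _ = _ + X]RintegralZl// -RintegralD//; [|exact: intZ..].
by apply: eq_Rintegral => t _; rewrite cImM.
Qed.

Lemma CintegralB f g : Cintegrable f -> Cintegrable g ->
  Cintegral (fun t => f t - g t) = Cintegral f - Cintegral g.
Proof.
move=> cf cg; rewrite -[in RHS]mulN1r -CintegralZ// -CintegralD//.
  by congr Cintegral; apply/funext => t; rewrite mulN1r.
exact: CintegrableZ.
Qed.

Lemma CintegralR (f : T -> R) : m.-integrable D (EFin \o f) ->
  Cintegral (fun t => (f t)%:C) = (\int[m]_(t in D) f t)%:C.
Proof.
move=> fi; apply: complex_eqP => //=.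
by rewrite Rintegral_cst// mul0r.
Qed.

Lemma CintegrableR (f : T -> R) : m.-integrable D (EFin \o f) ->
  Cintegrable (fun t => (f t)%:C).
Proof. by move=> fi; split => //; exact: integrable0. Qed.

Lemma Cintegrable_le f (h : T -> R) :
  measurable_fun D (fun t => Re (f t)) -> measurable_fun D (fun t => Im (f t)) ->
  m.-integrable D (EFin \o h) -> (forall t, D t -> normc (f t) <= h t) ->
  Cintegrable f.
Proof.
move=> mr mi hi fh; split; apply: (le_integrable mD _ _ hi).
- exact/measurable_EFinP.
- move=> t Dt /=; rewrite lee_fin (le_trans (normRe_le _))//.
  by rewrite (le_trans (fh _ Dt))// ler_norm.
- exact/measurable_EFinP.
- move=> t Dt /=; rewrite lee_fin (le_trans (normIm_le _))//.
  by rewrite (le_trans (fh _ Dt))// ler_norm.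
Qed.

(** The factor 2 comes from bounding the real and the imaginary part
    separately. *)
Lemma le_normc_Cintegral f (h : T -> R) : Cintegrable f ->
  m.-integrable D (EFin \o h) -> (forall t, D t -> normc (f t) <= h t) ->
  normc (Cintegral f) <= 2 * \int[m]_(t in D) h t.
Proof.
move=> [fr fi] hi fh; rewrite (le_trans (normc_leReIm _))// mulr_natl mulr2n.
rewrite lerD//=.
  rewrite (le_trans (le_normr_Rintegral mD fr))//.
  apply: le_Rintegral => //; first exact: integrable_norm.
  by move=> t Dt; exact: le_trans (normRe_le _) (fh _ Dt).
rewrite (le_trans (le_normr_Rintegral mD fi))//.
apply: le_Rintegral => //; first exact: integrable_norm.
by move=> t Dt; exact: le_trans (normIm_le _) (fh _ Dt).
Qed.

End complex_integral.

Section integrable_closure.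
Context d (T : measurableType d) {R : realType}.
Variables (m : {measure set T -> \bar R}) (D : set T).
Hypothesis mD : measurable D.
Implicit Types f g : T -> R.

Lemma RintegrableD f g : m.-integrable D (EFin \o f) ->
  m.-integrable D (EFin \o g) -> m.-integrable D (EFin \o (fun t => f t + g t)).
Proof. by move=> fi gi; have := integrableD mD fi gi; exact: eq_integrable. Qed.

Lemma RintegrableZ (k : R) f : m.-integrable D (EFin \o f) ->
  m.-integrable D (EFin \o (fun t => k * f t)).
Proof. by move=> fi; have := integrableZl mD k fi; exact: eq_integrable. Qed.

End integrable_closure.

Lemma Rintegral_cst_probability d (T : measurableType d) {R : realType}
  (P : probability T R) (r : R) : \int[P]_t r = r.
Proof.
rewrite Rintegral_cst// -[RHS]mulr1 -[X in _ = _ * X]/(fine 1%E).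
by congr (_ * fine _); exact: probability_setT.
Qed.

(** * The Cauchy transform of one dilated summand *)

Section resolvent.
Context {R : realType} (mu : probability R R).

Definition moment (k : nat) : R := \int[mu]_t (t ^+ k).
Definition amoment (k : nat) : R := fine (abs_moment mu k).

Hypothesis mu6 : (abs_moment mu 6 < +oo)%E.
Hypothesis mean0 : moment 1 = 0.
Hypothesis var1 : moment 2 = 1.

(** $|t|^k \le 1 + |t|^6$ for $k \le 6$. *)
Lemma integrable_absX k : (k <= 6)%N ->
  mu.-integrable setT (EFin \o (fun t : R => `|t| ^+ k)).
Proof.
move=> k6.
have mX j : measurable_fun setT (fun t : R => `|t| ^+ j).
  by apply: measurable_funX; exact: normr_measurable.
have i6 : mu.-integrable setT (EFin \o (fun t : R => `|t| ^+ 6)).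
  apply/integrableP; split; first exact/measurable_EFinP.
  move: mu6; rewrite /abs_moment unlock; apply: le_lt_trans.
  rewrite le_eqVlt; apply/orP; left; apply/eqP; apply: eq_integral => t _ /=.
  by rewrite ger0_norm// exprn_ge0.
have i7 : mu.-integrable setT (EFin \o (fun t : R => 1 + `|t| ^+ 6)).
  apply: RintegrableD => //.
  exact: finite_measure_integrable_cst.
apply: (le_integrable _ _ _ i7) => //; first exact/measurable_EFinP.
move=> t _ /=; rewrite lee_fin normrX normr_id.
rewrite [leRHS]ger0_norm ?addr_ge0 ?exprn_ge0//.
have [t1|t1] := leP `|t| 1.
  by rewrite (@le_trans _ _ 1)// ?exprn_ile1// lerDl exprn_ge0.
by rewrite (@le_trans _ _ (`|t| ^+ 6))// ?lerDr// ler_eXn2l.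
Qed.

Lemma integrableX k : (k <= 6)%N ->
  mu.-integrable setT (EFin \o (fun t : R => t ^+ k)).
Proof.
move=> /integrable_absX; apply: le_integrable => //.
  by apply/measurable_EFinP; exact: exprn_measurable.
by move=> t _ /=; rewrite normrX normrX normr_id.
Qed.

Lemma moment0 : moment 0 = 1.
Proof.
rewrite /moment; under eq_Rintegral do rewrite expr0.
exact: Rintegral_cst_probability.
Qed.

Lemma amomentE k : amoment k = \int[mu]_t (`|t| ^+ k).
Proof. by rewrite /amoment /abs_moment unlock. Qed.

Lemma amoment_ge0 k : 0 <= amoment k.
Proof. by rewrite amomentE; apply: Rintegral_ge0 => t _; rewrite exprn_ge0. Qed.

Lemma moment_le_amoment k : (k <= 6)%N -> `|moment k| <= amoment k.
Proof.
move=> k6; rewrite amomentE (le_trans (le_normr_Rintegral _ (integrableX k6)))//.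
rewrite le_eqVlt; apply/orP; left; apply/eqP.
by apply: eq_Rintegral => t _; rewrite normrX.
Qed.

Variables (w : R[i]) (th : R).
Hypothesis w0 : 0 < Im w.

Definition resolvent (t : R) : R[i] := (w - (th * t)%:C)^-1.

Let Imwt t : Im (w - (th * t)%:C) = Im w.
Proof. by rewrite cImD cImN /= subr0. Qed.

Let Rewt t : Re (w - (th * t)%:C) = Re w - th * t.
Proof. by rewrite cReD cReN. Qed.

Let wt0 t : w - (th * t)%:C != 0.
Proof. by apply: neq0_Im; rewrite Imwt. Qed.

Let swt t : normc (w - (th * t)%:C) ^+ 2 = (Re w - th * t) ^+ 2 + Im w ^+ 2.
Proof. by rewrite sqr_normcE Imwt Rewt. Qed.

Let swt0 t : 0 < (Re w - th * t) ^+ 2 + Im w ^+ 2.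
Proof. by rewrite ltr_wpDl ?sqr_ge0// exprn_gt0. Qed.

Lemma resolventK t : (w - (th * t)%:C) * resolvent t = 1.
Proof. by rewrite mulfV. Qed.

Lemma normc_resolvent t : normc (resolvent t) <= (Im w)^-1.
Proof.
rewrite normcV lef_pV2 ?posrE ?normc_gt0//.
by rewrite (le_trans _ (normIm_le _))// Imwt ler_norm.
Qed.

Let mlin : measurable_fun setT (fun t : R => Re w - th * t).
Proof. by apply: measurable_funB => //; exact: measurable_funM. Qed.

Let minv : measurable_fun setT (fun t : R => ((Re w - th * t) ^+ 2 + Im w ^+ 2)^-1).
Proof.
apply: continuous_measurable_fun => t.
apply: cvgV; first by rewrite gt_eqF.
apply: cvgD; last exact: cvg_cst.
apply: (@continuous_comp _ _ _ (fun t => Re w - th * t) (fun x => x ^+ 2)).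
  apply: cvgB; first exact: cvg_cst.
  by apply: cvgM; [exact: cvg_cst|exact: cvg_id].
exact: exprn_continuous.
Qed.

Lemma measurable_Re_resolvent : measurable_fun setT (fun t => Re (resolvent t)).
Proof.
have -> : (fun t => Re (resolvent t)) =
    (fun t => (Re w - th * t) * ((Re w - th * t) ^+ 2 + Im w ^+ 2)^-1).
  by apply/funext => t; rewrite /resolvent cReV swt Rewt.
exact: measurable_funM.
Qed.

Lemma measurable_Im_resolvent : measurable_fun setT (fun t => Im (resolvent t)).
Proof.
have -> : (fun t => Im (resolvent t)) =
    (fun t => (- Im w) * ((Re w - th * t) ^+ 2 + Im w ^+ 2)^-1).
  by apply/funext => t; rewrite /resolvent cImV swt Imwt mulNr.
exact: measurable_funM.
Qed.

Lemma Im_resolvent t : Im (resolvent t) = - (Im w * normc (resolvent t) ^+ 2).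
Proof. by rewrite /resolvent cImV Imwt normcV exprVn. Qed.

Definition resolvent_moment (k : nat) : R[i] :=
  Cintegral mu setT (fun t => (t ^+ k)%:C * resolvent t).
Local Notation K := resolvent_moment.

Lemma Cintegrable_resolvent k : (k <= 6)%N ->
  Cintegrable mu setT (fun t => (t ^+ k)%:C * resolvent t).
Proof.
move=> k6.
have ih := RintegrableZ measurableT (Im w)^-1 (integrable_absX k6).
apply: (@Cintegrable_le _ _ _ mu _ _ _ (fun t => (Im w)^-1 * `|t| ^+ k)) => //.
- have -> : (fun t => Re ((t ^+ k)%:C * resolvent t)) =
      (fun t => t ^+ k * Re (resolvent t)).
    by apply/funext => t; rewrite cReM/= mul0r subr0.
  apply: measurable_funM; [exact: exprn_measurable|exact: measurable_Re_resolvent].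
- have -> : (fun t => Im ((t ^+ k)%:C * resolvent t)) =
      (fun t => t ^+ k * Im (resolvent t)).
    by apply/funext => t; rewrite cImM/= mul0r addr0.
  apply: measurable_funM; [exact: exprn_measurable|exact: measurable_Im_resolvent].
- move=> t _; rewrite normcM normcR normrX mulrC ler_wpM2r ?exprn_ge0//.
  exact: normc_resolvent.
Qed.

Lemma resolvent_moment_bound k : (k <= 6)%N ->
  normc (K k) <= 2 * amoment k / Im w.
Proof.
move=> k6; have ih := RintegrableZ measurableT (Im w)^-1 (integrable_absX k6).
apply: (le_trans (le_normc_Cintegral measurableT (Cintegrable_resolvent k6) ih _)).
  move=> t _; rewrite normcM normcR normrX mulrC ler_wpM2r ?exprn_ge0//.
  exact: normc_resolvent.
by rewrite RintegralZl//; [rewrite -amomentE; lra|exact: integrable_absX].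
Qed.

(** Multiplying $w - \theta t$ by its inverse links consecutive moments; six
    uses of this recursion give the expansion of the Cauchy transform. *)
Lemma resolvent_moment_rec k : (k < 6)%N ->
  w * K k = (moment k)%:C + th%:C * K k.+1.
Proof.
move=> k6; rewrite /K.
rewrite -CintegralZ//; last exact: (Cintegrable_resolvent (ltnW k6)).
rewrite -CintegralZ//; last exact: (Cintegrable_resolvent k6).
rewrite -CintegralR//; last exact: (integrableX (ltnW k6)).
rewrite -CintegralD//; last 2 first.
- exact: CintegrableR (integrableX (ltnW k6)).
- exact: CintegrableZ (Cintegrable_resolvent k6).
congr Cintegral; apply/funext => t.
rewrite -[X in _ = X + _]mulr1 -(resolventK t) exprS rmorphM /=.
by rewrite !rmorphM /=; ring.
Qed.

Local Notation G := (K 0).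
Local Notation F := (G^-1).

Definition resolvent_energy : R := \int[mu]_t (normc (resolvent t) ^+ 2).
Local Notation V := resolvent_energy.

Let GE : G = Cintegral mu setT resolvent.
Proof. by congr Cintegral; apply/funext => t; rewrite expr0 mul1r. Qed.

Let iG : Cintegrable mu setT resolvent.
Proof.
have := Cintegrable_resolvent (leq0n 6); congr Cintegrable.
by apply/funext => t; rewrite expr0 mul1r.
Qed.

Let iV : mu.-integrable setT (EFin \o (fun t => normc (resolvent t) ^+ 2)).
Proof.
have := RintegrableZ measurableT (- (Im w)^-1) iG.2.
apply: eq_integrable => // t _ /=; rewrite Im_resolvent mulrNN mulKf//.
by rewrite gt_eqF.
Qed.

Lemma Im_resolvent_moment0 : Im G = - (Im w * V).
Proof.
rewrite GE /= /V -mulNr -RintegralZl//.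
by apply: eq_Rintegral => t _; rewrite Im_resolvent mulNr.
Qed.

(** By convexity of $s \mapsto 1/s$, the mean of $|w-\theta t|^{-2}$ is at least
    the inverse of the mean $|w|^2 + \theta^2$ of $|w-\theta t|^2$. *)
Lemma resolvent_energy_gt0 : 0 < V.
Proof.
pose S := normc w ^+ 2 + th ^+ 2.
have S0 : 0 < S by rewrite ltr_pwDl ?sqr_ge0// exprn_gt0// normc_gt0 neq0_Im.
(* tangent line of s |-> 1/s at S *)
have le1 t : 2 / S - (normc w ^+ 2 - 2 * th * Re w * t + th ^+ 2 * t ^+ 2) / S ^+ 2
    <= normc (resolvent t) ^+ 2.
  rewrite normcV exprVn swt.
  have := swt0 t; set s := (X in 0 < X) => s0.
  have -> : normc w ^+ 2 - 2 * th * Re w * t + th ^+ 2 * t ^+ 2 = s.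
    by rewrite sqr_normcE /s; ring.
  rewrite -subr_ge0.
  have -> : s^-1 - (2 / S - s / S ^+ 2) = (S - s) ^+ 2 / (s * S ^+ 2).
    by field; rewrite !gt_eqF.
  by rewrite divr_ge0 ?sqr_ge0// mulr_ge0 ?sqr_ge0// ltW.
have i1 := @integrableX 1 isT; have i2 := @integrableX 2 isT.
have i0 := @integrableX 0 isT.
have il : mu.-integrable setT (EFin \o (fun t => (2 / S - normc w ^+ 2 / S ^+ 2) * t ^+ 0 +
   ((2 * th * Re w) / S ^+ 2 * t ^+ 1 + (- th ^+ 2 / S ^+ 2) * t ^+ 2))).
  apply: RintegrableD => //; first exact: RintegrableZ.
  by apply: RintegrableD => //; exact: RintegrableZ.
(* the tangent line integrates to 1/S *)
have : S^-1 <= V; last by apply: lt_le_trans; rewrite invr_gt0.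
apply: le_trans (le_Rintegral _ il iV _) => //; last first.
  move=> t _; apply: le_trans (le1 t); rewrite le_eqVlt; apply/orP; left; apply/eqP.
  by rewrite expr0 expr1; ring.
rewrite RintegralD//; [|exact: RintegrableZ|]; last first.
  by apply: RintegrableD => //; exact: RintegrableZ.
rewrite RintegralD//; [|exact: RintegrableZ|exact: RintegrableZ].
rewrite !RintegralZl// -/(moment 0) -/(moment 1) -/(moment 2) moment0 mean0 var1.
rewrite le_eqVlt; apply/orP; left; apply/eqP.
have -> : normc w ^+ 2 = S - th ^+ 2 by rewrite /S addrK.
by field; rewrite gt_eqF.
Qed.

Lemma Im_cauchy_lt0 : Im G < 0.
Proof. by rewrite Im_resolvent_moment0 oppr_lt0 mulr_gt0 ?resolvent_energy_gt0. Qed.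

Let G0 : G != 0.
Proof.
by apply/eqP => G0; have := Im_cauchy_lt0; rewrite G0 ltxx.
Qed.

Let nG0 : 0 < normc G. Proof. by rewrite normc_gt0. Qed.

(** The relative excess of the imaginary part under $F$; it is the variance of
    $F(w)/(w-\theta t)$. *)
Definition excess : R := V / normc G ^+ 2 - 1.
Local Notation X := excess.

Lemma Im_recip : Im F = Im w * (1 + X).
Proof.
by rewrite cImV Im_resolvent_moment0 /X; field; rewrite gt_eqF.
Qed.

Let h t := F * resolvent t - 1.

Let sqr_h t : normc (h t) ^+ 2 =
  normc F ^+ 2 * normc (resolvent t) ^+ 2 + (- 2 * Re (F * resolvent t) + 1).
Proof.
rewrite -exprMn -normcM /h !sqr_normcE cReD cImD cReN cImN /=; ring.
Qed.

Let iFr : Cintegrable mu setT (fun t => F * resolvent t).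
Proof. exact: CintegrableZ. Qed.

Let ih : mu.-integrable setT (EFin \o (fun t => normc (h t) ^+ 2)).
Proof.
have : mu.-integrable setT (EFin \o (fun t => normc F ^+ 2 * normc (resolvent t) ^+ 2 +
   (- 2 * Re (F * resolvent t) + 1))).
  apply: RintegrableD => //; first exact: RintegrableZ.
  apply: RintegrableD => //; first by apply: RintegrableZ => //; case: iFr.
  exact: finite_measure_integrable_cst.
by apply: eq_integrable => // t _; rewrite /= sqr_h.
Qed.

Let Eh : \int[mu]_t (normc (h t) ^+ 2) = X.
Proof.
under eq_Rintegral do rewrite sqr_h.
rewrite RintegralD//; [|exact: RintegrableZ|]; last first.
  apply: RintegrableD => //; first by apply: RintegrableZ => //; case: iFr.
  exact: finite_measure_integrable_cst.
rewrite RintegralD//; [|by apply: RintegrableZ => //; case: iFr|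
  exact: finite_measure_integrable_cst].
rewrite !RintegralZl//; [|by case: iFr].
rewrite Rintegral_cst_probability.
have -> : \int[mu]_t Re (F * resolvent t) = 1.
  have : Re (Cintegral mu setT (fun t => F * resolvent t)) = 1.
    by rewrite CintegralZ// -GE mulVf.
  by [].
by rewrite /X /V normcV exprVn; ring.
Qed.

Lemma excess_ge0 : 0 <= X.
Proof. by rewrite -Eh; apply: Rintegral_ge0 => t _; rewrite sqr_ge0. Qed.

Local Notation d := (w - F).

(** From $w\,G = 1 + \theta K_1$, where $K_k$ is the integral of
    $t^k/(w-\theta t)$. *)
Lemma displacementE : d = th%:C * (F * K 1).
Proof.
have := @resolvent_moment_rec 0 isT; rewrite moment0 => e.
have -> : d = (w * G - 1) * F by rewrite mulrBl mul1r mulfK.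
by rewrite e /=; ring.
Qed.

(** Since $\mu$ has mean zero, $F K_1 = \int t\,(F/(w-\theta t)-1)$, and $\mu$
    has variance one, so Cauchy-Schwarz applies. *)
Lemma sqr_displacement_le : normc d ^+ 2 <= th ^+ 2 * X.
Proof.
rewrite displacementE normcM exprMn normcR real_normK ?num_real//.
rewrite ler_wpM2l ?sqr_ge0//; set c := F * K 1.
have i1 := @integrableX 1 isT; have i2 := @integrableX 2 isT.
have ith : Cintegrable mu setT (fun t => (t ^+ 1)%:C * h t).
  have := CintegrableD measurableT (CintegrableZ measurableT F (@Cintegrable_resolvent 1 isT))
    (CintegrableZ measurableT (-1) (CintegrableR i1)).
  congr Cintegrable; apply/funext => t; rewrite /h; ring.
have cE : Cintegral mu setT (fun t => (t ^+ 1)%:C * h t) = c.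
  have -> : (fun t => (t ^+ 1)%:C * h t) =
     (fun t => F * ((t ^+ 1)%:C * resolvent t) + (-1) * (t ^+ 1)%:C).
    by apply/funext => t; rewrite /h; ring.
  rewrite CintegralD//; last 2 first.
  - exact: CintegrableZ (@Cintegrable_resolvent 1 isT).
  - exact: CintegrableZ (CintegrableR i1).
  rewrite CintegralZ//; last exact: (@Cintegrable_resolvent 1 isT).
  rewrite CintegralZ//; last exact: CintegrableR.
  by rewrite CintegralR// -/(moment 1) mean0 mulr0 addr0.
(* cc is the conjugate of c; expand |h - c t|^2 >= 0 and integrate *)
pose cc : R[i] := Re c +i* (- Im c).
have icth := CintegrableZ measurableT cc ith.
have ir : mu.-integrable setT (EFin \o (fun t => normc (h t) ^+ 2 + normc c ^+ 2 * t ^+ 2)).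
  by apply: RintegrableD => //; exact: RintegrableZ.
have : \int[mu]_t (2 * Re (cc * ((t ^+ 1)%:C * h t))) <=
    \int[mu]_t (normc (h t) ^+ 2 + normc c ^+ 2 * t ^+ 2).
  apply: le_Rintegral => //; first by apply: RintegrableZ => //; case: icth.
  move=> t _; rewrite !sqr_normcE -subr_ge0.
  set rhs := (X in 0 <= X).
  have -> : rhs = (Re (h t) - Re c * t) ^+ 2 + (Im (h t) - Im c * t) ^+ 2.
    rewrite /rhs !(cReM,cImM) /=; ring.
  by rewrite addr_ge0 ?sqr_ge0.
rewrite RintegralZl//; last by case: icth.
rewrite RintegralD//; last exact: RintegrableZ.
rewrite RintegralZl// Eh -/(moment 2) var1.
have -> : \int[mu]_t Re (cc * ((t ^+ 1)%:C * h t)) = normc c ^+ 2.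
  have : Re (Cintegral mu setT (fun t => cc * ((t ^+ 1)%:C * h t))) = normc c ^+ 2.
    by rewrite CintegralZ// cE sqr_normcE cReM /cc/=; ring.
  by [].
lra.
Qed.

(** Tested against $(w-\theta t)t$, the function $F/(w-\theta t)-1$ has integral
    $\theta$, so its variance cannot be small unless $|w|$ is large. *)
Lemma excess_lower_bound :
  th ^+ 2 <= X * (2 * normc w ^+ 2 + 2 * th ^+ 2 * moment 4).
Proof.
have i1 := @integrableX 1 isT; have i2 := @integrableX 2 isT.
have i4 := @integrableX 4 isT.
set S := 2 * normc w ^+ 2 + _.
have m4 : 0 <= moment 4.
  by apply: Rintegral_ge0 => t _; rewrite (_ : 4 = 2 * 2)%N// exprM sqr_ge0.
have S0 : 0 < S.
  apply: ltr_pwDl; first by rewrite mulr_gt0// exprn_gt0// normc_gt0 neq0_Im.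
  by rewrite mulr_ge0// mulr_ge0// sqr_ge0.
(* q minimizes the integral of |h - q conj(w - th t) t|^2 *)
pose q := th / S.
have : \int[mu]_t (2 * q * (th * t ^+ 2 + - Re d * t ^+ 1)) <=
  \int[mu]_t (normc (h t) ^+ 2 + q ^+ 2 * (2 * normc w ^+ 2 * t ^+ 2 + 2 * th ^+ 2 * t ^+ 4)).
  apply: le_Rintegral => //.
  - apply: RintegrableZ => //; apply: RintegrableD => //; exact: RintegrableZ.
  - apply: RintegrableD => //; apply: RintegrableZ => //; apply: RintegrableD => //;
      exact: RintegrableZ.
  move=> t _.
  have hE : h t * (w - (th * t)%:C) = (th * t)%:C - d.
    by rewrite /h mulrBl -mulrA (mulrC (resolvent t)) resolventK; ring.
  have -> : th * t ^+ 2 + - Re d * t ^+ 1 = t * Re (h t * (w - (th * t)%:C)).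
    by rewrite hE !(cReD, cReN) /=; ring.
  apply: (@le_trans _ _ (normc (h t) ^+ 2 + q ^+ 2 * t ^+ 2 * normc (w - (th * t)%:C) ^+ 2)).
    rewrite !sqr_normcE -subr_ge0; set u := w - _; set rhs := (X in 0 <= X).
    have -> : rhs = (Re (h t) - q * t * Re u) ^+ 2 + (Im (h t) + q * t * Im u) ^+ 2.
      by rewrite /rhs cReM; ring.
    by rewrite addr_ge0 ?sqr_ge0.
  rewrite lerD2l -mulrA ler_wpM2l ?sqr_ge0//.
  rewrite swt sqr_normcE -subr_ge0; set rhs := (X in 0 <= X).
  have -> : rhs = t ^+ 2 * ((Re w + th * t) ^+ 2 + Im w ^+ 2) by rewrite /rhs; ring.
  by rewrite mulr_ge0 ?sqr_ge0// addr_ge0 ?sqr_ge0.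
rewrite RintegralZl//; last by apply: RintegrableD => //; exact: RintegrableZ.
rewrite RintegralD//; [|exact: RintegrableZ|exact: RintegrableZ].
rewrite RintegralD//; last by apply: RintegrableZ => //; apply: RintegrableD => //; exact: RintegrableZ.
rewrite [X in _ <= _ + X]RintegralZl//; last by apply: RintegrableD => //; exact: RintegrableZ.
rewrite [X in _ <= _ + _ * X]RintegralD//; [|exact: RintegrableZ|exact: RintegrableZ].
rewrite !RintegralZl// Eh -/(moment 1) -/(moment 2) -/(moment 4) mean0 var1.
rewrite !mulr1 mulr0 addr0 -/S => le1.
rewrite -ler_pdivrMr//.
have e1 : q ^+ 2 * S = th ^+ 2 / S by rewrite /q; field; rewrite gt_eqF.
have e2 : 2 * q * th = 2 * (th ^+ 2 / S) by rewrite /q; ring.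
by move: le1; rewrite e1 e2; lra.
Qed.

End resolvent.

(** * Expansion of the displacement of one summand *)

Section expansion_constants.
Context {R : realType}.
Variables b3 b4 b5 b6 : R.

(** The numerical factors collect the bounds $|1/w| \le 3$, $|G| \le 3$ and
    $|F/w| \le 2$, and $b_k$ stands for the $k$-th absolute moment: [tail_const]
    bounds $w^{-2}K_4$, [second_const] bounds $K_2$, and [expansion_const] the
    coefficient of $\theta^4$ in the remainder of the displacement. *)
Definition tail_const : R := 9 * (3 * b4 + 9 * b5 + 9 * b6 / 8).
Definition second_const : R := 3 + 9 * b3 + tail_const.
Definition expansion_const : R :=
  36 * second_const + 162 * b3 * second_const + 2 * tail_const.

End expansion_constants.

Lemma normcM_le {R : realType} (x y : R[i]) a b :
  normc x <= a -> normc y <= b -> normc (x * y) <= a * b.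
Proof. by move=> xa yb; rewrite normcM ler_pM ?normc_ge0. Qed.

Lemma sqr_normc_le9 {R : realType} (x : R[i]) : normc x <= 3 -> normc x ^+ 2 <= 9.
Proof. by have := normc_ge0 x; nra. Qed.

Section one_summand.
Context {R : realType}.
Variables (w G : R[i]) (th m3 m4 m5 b3 b4 b5 b6 : R) (K1 K2 K3 K4 K5 K6 : R[i]).
Local Notation F := (G^-1).
Local Notation d := (w - F).
Local Notation h := (w^-1).
Hypotheses (m3b : `|m3| <= b3) (m4b : `|m4| <= b4) (m5b : `|m5| <= b5).
Hypothesis wlarge : 3 / 8 <= normc w.
Hypothesis Flarge : 7 / 16 <= normc F.
Hypothesis dsmall : normc d <= 1 / 16.
Hypothesis th1 : `|th| <= 1.
(* K6 alone may be as large as 1 / Im w *)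
Hypothesis thw : th ^+ 2 * normc K6 <= b6 / 8.
Hypothesis dE : d = th%:C * (F * K1).
Hypothesis K1E : w * K1 = th%:C * K2.
Hypothesis K2E : w * K2 = 1 + th%:C * K3.
Hypothesis K3E : w * K3 = m3%:C + th%:C * K4.
Hypothesis K4E : w * K4 = m4%:C + th%:C * K5.
Hypothesis K5E : w * K5 = m5%:C + th%:C * K6.

Local Notation B1 := (tail_const b4 b5 b6).
Local Notation B2 := (second_const b3 b4 b5 b6).
Local Notation B3 := (expansion_const b3 b4 b5 b6).

Let w0 : w != 0.
Proof. by rewrite -normc_gt0; apply: lt_le_trans wlarge; lra. Qed.

Let G0 : G != 0.
Proof.
by rewrite -invr_eq0 -normc_gt0; apply: lt_le_trans Flarge; lra.
Qed.

Let hle : normc h <= 3.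
Proof.
rewrite normcV (le_trans (y := (3 / 8)^-1))//; last by rewrite invf_div; lra.
by rewrite lef_pV2// ?posrE ?normc_gt0//; lra.
Qed.

Let Gle : normc G <= 3.
Proof.
rewrite -[G]invrK normcV (le_trans (y := (7 / 16)^-1))//; last by rewrite invf_div; lra.
by rewrite lef_pV2// ?posrE ?normc_gt0 ?invr_eq0//; lra.
Qed.

Let divw x y : w * x = y -> x = h * y.
Proof. by move=> <-; rewrite mulKf. Qed.

Let b30 : 0 <= b3. Proof. exact: le_trans m3b. Qed.

Let tail_le : normc (h ^+ 2 * K4) <= B1.
Proof.
have -> : h ^+ 2 * K4 =
    h ^+ 2 * (h * m4%:C + h ^+ 2 * (th%:C * m5%:C) + h ^+ 2 * (th%:C ^+ 2 * K6)).
  by rewrite (divw K4E) (divw K5E); ring.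
rewrite normcM normcX /tail_const.
have h2 : normc h ^+ 2 <= 9.
  exact: sqr_normc_le9.
apply: ler_pM; rewrite ?normc_ge0 ?exprn_ge0//; first exact: normc_ge0.
apply: le_trans (le_normcD _ _) _; apply: lerD.
  apply: le_trans (le_normcD _ _) _; apply: lerD.
    by rewrite normcM normcR ler_pM ?normc_ge0.
  rewrite !(normcX, normcM, normcR) ler_pM ?sqr_ge0 ?mulr_ge0//.
  by rewrite -[leRHS]mul1r ler_pM.
rewrite !(normcX, normcM, normcR) real_normK ?num_real// -mulrA ler_pM ?sqr_ge0//.
by rewrite mulr_ge0 ?sqr_ge0 ?normc_ge0.
Qed.

Let K2E' : K2 = h + th%:C * m3%:C * h ^+ 2 + th%:C ^+ 2 * (h ^+ 2 * K4).
Proof. by rewrite (divw K2E) (divw K3E); ring. Qed.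

Let thX k : normc (th%:C ^+ k) <= 1.
Proof. by rewrite normcX normcR exprn_ile1. Qed.

Let K2le : normc K2 <= B2.
Proof.
rewrite K2E'; apply: le_trans (le_normcD _ _) _; apply: lerD; last first.
  by rewrite normcM -[leRHS]mul1r ler_pM ?normc_ge0.
apply: le_trans (le_normcD _ _) _; apply: lerD => //.
rewrite !(normcX, normcM, normcR) mulrC ler_pM ?sqr_ge0 ?mulr_ge0//.
  exact: sqr_normc_le9.
by rewrite -[leRHS]mul1r ler_pM.
Qed.

Let FhE : F * h = 1 - d * h.
Proof. by field; rewrite w0 G0. Qed.

Let Fhle : normc (F * h) <= 2.
Proof.
rewrite FhE; apply: le_trans (le_normcB _ _) _; rewrite normc1 normcM.
have : normc d * normc h <= 1 / 16 * 3 by rewrite ler_pM ?normc_ge0.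
lra.
Qed.

Let dle : normc d <= 2 * B2 * th ^+ 2.
Proof.
have -> : d = F * h * (K2 * th%:C ^+ 2) by rewrite dE (divw K1E); ring.
rewrite normcM (normcM K2) normcX normcR real_normK ?num_real// -[leRHS]mulrA.
apply: ler_pM; rewrite ?normc_ge0//; last by rewrite ler_wpM2r ?sqr_ge0.
by rewrite mulr_ge0 ?normc_ge0 ?sqr_ge0.
Qed.

(** Since $d = \theta^2 (F/w) K_2$ and $K_2 = 1/w + \theta m_3/w^2 + O(\theta^2)$,
    it only remains to replace $F/w$ by $1$ and $1/w$ by $G$, at the cost of
    factors $d = O(\theta^2)$. *)
Lemma displacement_expansion :
  normc (d - (th ^+ 2)%:C * G - (th ^+ 3)%:C * (m3%:C * G ^+ 2))
  <= B3 * th ^+ 4.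
Proof.
set A := d * (h * (G + h)); set B := d * (h * (G * h + G ^+ 2 + h ^+ 2)).
have -> : d - (th ^+ 2)%:C * G - (th ^+ 3)%:C * (m3%:C * G ^+ 2) =
    th%:C ^+ 2 * (- A - th%:C * m3%:C * B + F * h * (th%:C ^+ 2 * (h ^+ 2 * K4))).
  have dE2 : d = th%:C ^+ 2 * (F * h * K2) by rewrite dE (divw K1E); ring.
  rewrite [X in X - _ - _]dE2 K2E' /A /B !rmorphXn /=.
  by field; rewrite w0 G0.
rewrite normcM normcX normcR real_normK ?num_real//.
rewrite (_ : B3 * th ^+ 4 = th ^+ 2 * (B3 * th ^+ 2)); last by ring.
rewrite ler_wpM2l ?sqr_ge0//.
have Gh : normc (G + h) <= 6.
  by have := le_normcD G h; have := Gle; have := hle; lra.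
have sq (x y : R[i]) : normc x <= 3 -> normc y <= 3 -> normc (x * y) <= 9.
  move=> x3 y3; rewrite normcM (le_trans (y := 3 * 3))//; last by lra.
  by rewrite ler_pM ?normc_ge0.
have GGh : normc (G * h + G ^+ 2 + h ^+ 2) <= 27.
  have := le_normcD (G * h + G ^+ 2) (h ^+ 2); have := le_normcD (G * h) (G ^+ 2).
  have := sq _ _ Gle hle; have := sq _ _ Gle Gle; have := sq _ _ hle hle.
  by rewrite !expr2; lra.
have Ale : normc A <= 36 * B2 * th ^+ 2.
  rewrite (_ : _ * th ^+ 2 = 2 * B2 * th ^+ 2 * (3 * 6)); last by ring.
  by do 2 (apply: normcM_le => //).
have Ble : normc B <= 162 * B2 * th ^+ 2.
  rewrite (_ : _ * th ^+ 2 = 2 * B2 * th ^+ 2 * (3 * 27)); last by ring.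
  by do 2 (apply: normcM_le => //).
have Bm : normc (th%:C * m3%:C * B) <= 162 * b3 * B2 * th ^+ 2.
  rewrite (_ : _ * th ^+ 2 = 1 * b3 * (162 * B2 * th ^+ 2)); last by ring.
  by do 2 (apply: normcM_le => //); rewrite normcR.
have Cm : normc (F * h * (th%:C ^+ 2 * (h ^+ 2 * K4))) <= 2 * B1 * th ^+ 2.
  rewrite (_ : _ * th ^+ 2 = 2 * (th ^+ 2 * B1)); last by ring.
  apply: normcM_le => //; rewrite normcM normcX normcR real_normK ?num_real//.
  by rewrite ler_wpM2l ?sqr_ge0.
apply: le_trans (le_normcD _ _) _.
have := le_normcB (- A) (th%:C * m3%:C * B); rewrite normcN.
by rewrite /expansion_const; lra.
Qed.

End one_summand.

(** * The subordination system at one point *)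

Section subordination.
Context {R : realType} (mu : probability R R).
Hypothesis mu6 : (abs_moment mu 6 < +oo)%E.
Hypothesis mean0 : moment mu 1 = 0.
Hypothesis var1 : moment mu 2 = 1.
Local Notation K := (resolvent_moment mu).
Local Notation b := (amoment mu).

Variables (n : nat) (th : 'I_n -> R) (W : 'I_n -> R[i]) (z G : R[i]).
Hypothesis n0 : (0 < n)%N.
Hypothesis z0 : 0 < Im z.
Hypothesis W0 : forall i, 0 < Im (W i).
Hypothesis WG : forall i, K (W i) (th i) 0 = G.
Hypothesis Wsum : \sum_(i < n) W i - z = n.-1%:R * G^-1.
Hypothesis th_norm : \sum_(i < n) th i ^+ 2 = 1.
Hypothesis th_im : forall i, th i ^+ 2 <= Im z / 16.
Hypothesis th_mom : forall i, th i ^+ 2 * (2 * b 4 + 1) <= 1 / 2.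

Local Notation F := (G^-1).
Local Notation X i := (excess mu (W i) (th i)).
Local Notation d i := (W i - F).

Let X0 i : 0 <= X i. Proof. exact: (excess_ge0 mu6 mean0 var1 (th i) (W0 i)). Qed.

Let ImF i : Im F = Im (W i) * (1 + X i).
Proof. by rewrite -(WG i); exact: (Im_recip mu6 mean0 var1 (th i) (W0 i)). Qed.

Let dsum : \sum_(i < n) d i = z - F.
Proof.
rewrite sumrB sumr_const card_ord (_ : F *+ n = F + n.-1%:R * F).
  by rewrite -Wsum; ring.
by rewrite mulr_natl -mulrS prednK.
Qed.

Let ImW_le i : Im (W i) <= Im F.
Proof. by rewrite (ImF i) ler_peMr ?lerDl// ltW. Qed.

Let ImF0 : 0 < Im F.
Proof. by apply: lt_le_trans (ImW_le (Ordinal n0)). Qed.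

(** Every $\Im d_j$ is nonpositive, so $\Im(z - F) = \sum_j \Im d_j$ is at most
    $\Im d_i = \Im Z_i - \Im F$. *)
Lemma subordination_Im_ge i : Im z <= Im (W i).
Proof.
have := congr1 (@complex.Im R) dsum; rewrite cIm_sum cImD cImN => e.
have : \sum_(j < n) Im (d j) <= Im (d i).
  rewrite (bigD1 i)//= gerDl sumr_le0// => j _.
  by rewrite cImD cImN subr_le0.
by rewrite e cImD cImN; lra.
Qed.

(** Combine $|d_i|^2 \le \theta_i^2 X_i$ with
    $X_i\,\Im Z_i = -\Im d_i \le |d_i|$ and divide by $|d_i|$. *)
Let dle i : normc (d i) * Im (W i) <= th i ^+ 2.
Proof.
have h1 := sqr_displacement_le mu6 mean0 var1 (th i) (W0 i).
rewrite WG in h1.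
have XW : X i * Im (W i) <= normc (d i).
  apply: le_trans (normIm_le _); rewrite cImD cImN.
  rewrite (_ : _ * _ = - (Im (W i) - Im F)); last by rewrite (ImF i); ring.
  by rewrite -normrN ler_norm.
have [->|dn0] := eqVneq (d i) 0; first by rewrite normc0 mul0r sqr_ge0.
rewrite -(@ler_pM2l _ (normc (d i))) ?normc_gt0// mulrA -expr2.
apply: (@le_trans _ _ (th i ^+ 2 * X i * Im (W i))).
  by rewrite ler_wpM2r// ltW.
by rewrite -mulrA (mulrC (normc _)) ler_wpM2l ?sqr_ge0.
Qed.

(** This is where $\theta_i^2 \le \Im z/16$ and $\Im z \le \Im Z_i$ meet. *)
Let dsmall i : normc (d i) <= 1 / 16.
Proof.
rewrite -(@ler_pM2r _ (Im (W i)))//; apply: le_trans (dle i) _.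
apply: le_trans (th_im i) _; have := subordination_Im_ge i; lra.
Qed.

(** If every $|Z_i|$ were at most $1/2$, the loss of imaginary part
    $\Im(Z_i - F)$ would be at most $-\theta_i^2\,\Im F$ for every $i$, and the
    sum over $i$ would give $\Im z \le 0$. *)
Lemma subordination_large : exists i, 1 / 2 < normc (W i).
Proof.
apply: contrapT => /forallNP small.
have le1 i : Im (d i) <= - (th i ^+ 2 * Im F).
  have h1 := excess_lower_bound mu6 mean0 var1 (th i) (W0 i).
  have /negP := small i; rewrite -leNgt => wle.
  have w2 : 2 * normc (W i) ^+ 2 <= 1 / 2.
    have : normc (W i) ^+ 2 <= (1 / 2) ^+ 2 by rewrite ler_pXn2r ?nnegrE ?normc_ge0.
    lra.
  have m4 : moment mu 4 <= b 4.
    by apply: le_trans (ler_norm _) _; exact: moment_le_amoment.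
  have tX : th i ^+ 2 * (1 + X i) <= X i.
    have t2 : th i ^+ 2 * moment mu 4 <= th i ^+ 2 * b 4 by rewrite ler_wpM2l ?sqr_ge0.
    have XM x y : x <= y -> X i * x <= X i * y by move=> xy; rewrite ler_wpM2l.
    have := XM _ _ (th_mom i); have := XM _ _ w2; have := XM _ _ t2.
    by move: h1; lra.
  have := ler_wpM2l (ltW (W0 i)) tX; rewrite cImD cImN (ImF i); lra.
have := congr1 (@complex.Im R) dsum; rewrite cIm_sum cImD cImN => e.
have : \sum_(i < n) Im (d i) <= \sum_(i < n) (- (th i ^+ 2 * Im F)).
  by apply: ler_sum => i _.
rewrite sumrN -mulr_suml th_norm mul1r e; have := z0; lra.
Qed.

(** One large $Z_i$ suffices: $7/16 = 1/2 - 1/16$, and then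
    $3/8 = 7/16 - 1/16$ bounds every $|Z_j|$ from below. *)
Let Flarge : 7 / 16 <= normc F.
Proof.
have [i wi] := subordination_large; have := dsmall i.
have := ger_normcB (W i) F; lra.
Qed.

Let Wlarge i : 3 / 8 <= normc (W i).
Proof. have := ger_normcB F (W i); rewrite normcBC; have := dsmall i; have := Flarge; lra. Qed.

Let G0 : G != 0.
Proof. by rewrite -invr_eq0 -normc_gt0; apply: lt_le_trans Flarge; lra. Qed.

Lemma subordination_cauchy_le : normc G <= 3.
Proof.
rewrite -[G]invrK normcV (le_trans (y := (7 / 16)^-1))//; last by rewrite invf_div; lra.
by rewrite lef_pV2// ?posrE ?normc_gt0 ?invr_eq0//; lra.
Qed.

Lemma subordination_cauchy_lt0 : Im G < 0.
Proof.
by rewrite -(WG (Ordinal n0)); exact: (Im_cauchy_lt0 mu6 mean0 var1 _ (W0 _)).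
Qed.

Let th1 i : `|th i| <= 1.
Proof.
rewrite -(@ler_pXn2r _ 2) ?nnegrE// real_normK ?num_real// expr1n -th_norm.
by rewrite (bigD1 i)//= lerDl sumr_ge0// => j _; rewrite sqr_ge0.
Qed.

Local Notation B3 := (expansion_const (b 3) (b 4) (b 5) (b 6)).

Let expand i :
  normc (d i - (th i ^+ 2)%:C * G - (th i ^+ 3)%:C * ((moment mu 3)%:C * G ^+ 2))
  <= B3 * th i ^+ 4.
Proof.
have rec k (k6 : (k < 6)%N) := resolvent_moment_rec mu6 (th i) (W0 i) k6.
have e1 := rec 1%N isT; rewrite mean0 add0r in e1.
have e2 := rec 2%N isT; rewrite var1 in e2.
have e := displacementE mu6 mean0 var1 (th i) (W0 i).
apply: (@displacement_expansion R (W i) G (th i) (moment mu 3) (moment mu 4)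
  (moment mu 5) (b 3) (b 4) (b 5) (b 6) (K (W i) (th i) 1) (K (W i) (th i) 2)
  (K (W i) (th i) 3) (K (W i) (th i) 4) (K (W i) (th i) 5) (K (W i) (th i) 6)).
- exact: moment_le_amoment.
- exact: moment_le_amoment.
- exact: moment_le_amoment.
- exact: Wlarge.
- exact: Flarge.
- exact: dsmall.
- exact: th1.
- have := resolvent_moment_bound mu6 (th i) (W0 i) (leqnn 6) => hK.
  apply: (@le_trans _ _ (Im (W i) / 16 * (2 * b 6 / Im (W i)))).
    rewrite ler_pM ?sqr_ge0 ?normc_ge0//.
    apply: le_trans (th_im i) _; have := subordination_Im_ge i; lra.
  rewrite le_eqVlt; apply/orP; left; apply/eqP; field.
  exact: lt0r_neq0 (W0 i).
- by move: e; rewrite WG.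
- exact: e1.
- exact: e2.
- exact: rec.
- exact: rec.
- exact: rec.
Qed.

(** Summing the expansions of $Z_i-F$ over $i$ turns the subordination system
    into an approximate quadratic equation for $G$. *)
Lemma approximate_quadratic_equation :
  normc (G + G^-1 - z) <=
  9 * b 3 * `|\sum_(i < n) th i ^+ 3| + B3 * \sum_(i < n) th i ^+ 4.
Proof.
pose E i := d i - (th i ^+ 2)%:C * G - (th i ^+ 3)%:C * ((moment mu 3)%:C * G ^+ 2).
have sE : \sum_(i < n) E i = z - F - G -
    (\sum_(i < n) th i ^+ 3)%:C * ((moment mu 3)%:C * G ^+ 2).
  rewrite /E sumrB sumrB -!mulr_suml dsum -!rmorph_sum /= th_norm.
  by rewrite rmorph1 mul1r.
have -> : G + G^-1 - z = - \sum_(i < n) E i -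
    (\sum_(i < n) th i ^+ 3)%:C * ((moment mu 3)%:C * G ^+ 2).
  by rewrite sE; ring.
apply: le_trans (le_normcB _ _) _; rewrite normcN addrC; apply: lerD.
  rewrite !(normcX, normcM, normcR) mulrC ler_wpM2r//.
  rewrite mulrC ler_pM ?sqr_ge0//; last exact: moment_le_amoment.
  exact/sqr_normc_le9/subordination_cauchy_le.
rewrite mulr_sumr; apply: le_trans (le_normc_sum _ _) _.
by apply: ler_sum => i _; exact: expand.
Qed.

End subordination.

(** * Stability of the semicircle equation *)

Section stability.
Context {R : realType}.
Variables (G g z : R[i]) (u v eps : R).
Hypothesis zE : z = u +i* v.
Hypothesis v0 : 0 < v.
Hypothesis v1 : v <= 1.
Hypothesis g_eq : g + g^-1 = z.
Hypothesis g0 : Im g < 0.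
Hypothesis eps0 : 0 <= eps.
Hypothesis eps4 : eps <= 4.
Hypothesis u_lo : - 2 + eps / 2 <= u.
Hypothesis u_hi : u <= 2 - eps / 2.

Let gn0 : 0 < normc g.
Proof. by apply: lt_le_trans (normIm_le _); rewrite normr_gt0 lt_eqF. Qed.

Let s := normc g ^+ 2.
Let s0 : 0 < s. Proof. by rewrite exprn_gt0. Qed.

Let Re_eq : Re g * (1 + s) = u * s.
Proof.
have := congr1 (@complex.Re R) g_eq; rewrite zE cReD cReV -/s /= => <-.
by field; rewrite gt_eqF.
Qed.

Let Im_eq : - Im g * (1 - s) = v * s.
Proof.
have := congr1 (@complex.Im R) g_eq; rewrite zE cImD cImV -/s /= => <-.
by field; rewrite gt_eqF.
Qed.

Let s1 : s < 1.
Proof.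
rewrite -subr_gt0 -(@pmulr_rgt0 _ (- Im g)) ?oppr_gt0// Im_eq.
by rewrite mulr_gt0.
Qed.

Let g1 : normc g <= 1.
Proof.
by rewrite -(@ler_pXn2r _ 2) ?nnegrE ?normc_ge0// expr1n ltW.
Qed.

Let g_ge : 1 / 4 <= normc g.
Proof.
have : normc (g^-1) <= 4.
  have -> : g^-1 = z - g by rewrite -g_eq addrAC subrr add0r.
  apply: le_trans (le_normcB _ _) _.
  have : normc z <= 3.
    apply: le_trans (normc_leReIm _) _; rewrite zE /=.
    have : `|u| <= 2.
      by rewrite ler_norml; have := eps0; have := u_lo; have := u_hi; lra.
    by rewrite (gtr0_norm v0); have := v1; lra.
  by have := g1; lra.
rewrite normcV => h; rewrite mul1r -[leRHS]invrK lef_pV2// posrE ?invr_gt0//.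
Qed.

(** With $s = |g|^2$, the real part of $g + 1/g = z$ gives
    $(1+s)^2 (\Im g)^2 = s(1+s)^2 - u^2s^2 \ge s^2(4 - u^2)$, where
    $4 - u^2 \ge \varepsilon$, $s \le 1$ and $|g| \ge 1/4$. *)
Lemma semicircle_Im_lower_bound : Num.sqrt eps / 32 <= - Im g.
Proof.
have sE : s = Re g ^+ 2 + Im g ^+ 2 by rewrite /s sqr_normcE.
have q2 : s ^+ 2 * eps / 4 <= Im g ^+ 2.
  have e1 : Im g ^+ 2 * (1 + s) ^+ 2 = s * (1 + s) ^+ 2 - u ^+ 2 * s ^+ 2.
    by rewrite -[X in _ - X]exprMn -Re_eq exprMn {2}sE; ring.
  have u2 : eps <= 4 - u ^+ 2.
    have : 0 <= (2 - eps / 2 - u) * (2 - eps / 2 + u).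
      by rewrite mulr_ge0//; have := u_lo; have := u_hi; lra.
    have : 0 <= eps * (4 - eps) by rewrite mulr_ge0// subr_ge0.
    lra.
  have : s ^+ 2 * eps <= Im g ^+ 2 * (1 + s) ^+ 2.
    rewrite e1; apply: (@le_trans _ _ (s ^+ 2 * (4 - u ^+ 2))).
      by rewrite ler_wpM2l ?sqr_ge0.
    have : 0 <= s * (1 - s) ^+ 2 by rewrite mulr_ge0 ?sqr_ge0 ?ltW.
    nra.
  have : Im g ^+ 2 * (1 + s) ^+ 2 <= Im g ^+ 2 * 4.
    rewrite ler_wpM2l ?sqr_ge0//; have := s0; have := s1; nra.
  lra.
have s16 : 1 / 16 <= s.
  rewrite (_ : 1 / 16 = (1 / 4) ^+ 2); last by field.
  by rewrite ler_pXn2r ?nnegrE ?normc_ge0//; lra.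
rewrite -(@ler_pXn2r _ 2)// ?nnegrE ?divr_ge0 ?sqrtr_ge0//; last first.
  by rewrite oppr_ge0 ltW.
rewrite sqrrN; apply: le_trans q2; rewrite expr_div_n sqr_sqrtr//.
have : (1 / 16) ^+ 2 * eps <= s ^+ 2 * eps.
  by rewrite ler_wpM2r// ler_pXn2r// nnegrE; have := s16; lra.
lra.
Qed.

(** Joukowski's map $G \mapsto G + 1/G$ is injective on the lower half-plane,
    quantitatively: $|1/g - G| \ge \Im(1/g)$ when $\Im G<0$. *)
Lemma semicircle_stability (r : R) : 0 < eps -> Im G < 0 -> normc G <= 3 ->
  normc (G + G^-1 - z) <= r -> normc (G - g) <= 96 * r / Num.sqrt eps.
Proof.
move=> epsp G0 G3 hr.
have r0 : 0 <= r by apply: le_trans hr; exact: normc_ge0.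
have Gn0 : G != 0 by apply/eqP => GE; move: G0; rewrite GE ltxx.
have gn : g != 0 by rewrite -normc_gt0.
have e1 : (G - g) * (G - g^-1) = (G + G^-1 - z) * G.
  by rewrite -g_eq; field; rewrite Gn0 gn.
have l1 : - Im g <= normc (G - g^-1).
  rewrite normcBC; apply: le_trans (normIm_le _).
  apply: le_trans (ler_norm _); rewrite cImD cImN cImV -/s.
  have : - Im g <= - (Im g / s).
    by rewrite lerN2 ler_pdivrMr// ler_niMr ?ltW.
  lra.
have l2 : normc (G - g) * - Im g <= 3 * r.
  apply: (@le_trans _ _ (normc (G - g) * normc (G - g^-1))).
    by rewrite ler_wpM2l ?normc_ge0.
  by rewrite -normcM e1 normcM mulrC ler_pM ?normc_ge0.
have q := semicircle_Im_lower_bound.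
have se : 0 < Num.sqrt eps by rewrite sqrtr_gt0.
rewrite ler_pdivlMr//.
have : normc (G - g) * (Num.sqrt eps / 32) <= 3 * r.
  by apply: le_trans l2; rewrite ler_wpM2l ?normc_ge0.
lra.
Qed.

End stability.

(** * Integration against a density and over an interval *)

Section density.
Context d (T : measurableType d) {R : realType}.
Variables (nu : {finite_measure set T -> \bar R})
  (lam : {sigma_finite_measure set T -> \bar R}) (p : T -> R).
Hypothesis mp : measurable_fun setT p.
Hypothesis nuE : forall A, measurable A -> nu A = (\int[lam]_(x in A) (p x)%:E)%E.

Let numu : nu `<< lam.
Proof.
apply/null_content_dominatesP => A mA lA0; rewrite nuE//.
by apply: null_set_integral => //; apply/measurable_funTS; exact/measurable_EFinP.
Qed.

(** The density is a version of the Radon-Nikodym derivative. *)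
Lemma integral_density (f : T -> R) : nu.-integrable setT (EFin \o f) ->
  \int[nu]_x f x = \int[lam]_x (f x * p x).
Proof.
move=> fi; have mf : measurable_fun setT (EFin \o f) := measurable_int _ fi.
rewrite /Rintegral -(Radon_Nikodym_change_of_variables numu)//; congr fine.
apply: ae_eq_integral => //.
- exact: emeasurable_funM.
- by apply/measurable_EFinP/measurable_funM => //; exact/measurable_EFinP.
- under [X in ae_eq _ _ _ X]eq_fun do rewrite EFinM.
  apply: ae_eqe_mul2l; apply: integral_ae_eq => //.
  + by apply: Radon_Nikodym_integrable; exact: numu.
  + exact/measurable_EFinP.
  + by move=> A _ mA; rewrite -Radon_Nikodym_integral// -nuE.
Qed.

End density.

Section calculus.
Context {R : realType}.
Local Notation lam := (@lebesgue_measure R).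

Lemma derivable_LRcontinuous (F : R -> R) (a b : R) :
  (forall x : R, derivable F x 1) -> derivable_oo_LRcontinuous F a b.
Proof.
move=> dF; have cF x : {for x, continuous F}.
  exact/differentiable_continuous/derivable1_diffP.
split=> [x _| |]; first exact: dF.
- exact/cvg_at_right_filter/cF.
- exact/cvg_at_left_filter/cF.
Qed.

Lemma continuous_integrable_itv (f : R -> R) (a b : R) : continuous f ->
  lam.-integrable `[a, b] (EFin \o f).
Proof.
move=> cf; apply: continuous_compact_integrable; first exact: segment_compact.
exact: continuous_subspaceT.
Qed.

Lemma Rintegral_derive (f F : R -> R) (a b : R) : a < b -> continuous f ->
  (forall x : R, is_derive x 1 F (f x)) -> \int[lam]_(x in `[a, b]) f x = F b - F a.
Proof.
move=> ab cf dF; rewrite /Rintegral (@continuous_FTC2 _ f F)//.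
- exact: continuous_subspaceT.
- by apply: derivable_LRcontinuous => x; have [] := dF x.
- by move=> x _; rewrite derive1E; have [] := dF x.
Qed.

Lemma continuous_scale (c : R) : continuous (fun x : R => c * x).
Proof. by move=> x; apply: cvgM; [exact: cvg_cst|exact: cvg_id]. Qed.

Lemma Rintegral_cos_mul (m : nat) : (0 < m)%N ->
  \int[lam]_(x in `[0, pi]) cos (m%:R * x) = 0.
Proof.
move=> m0; have mR : m%:R != 0 :> R by rewrite pnatr_eq0 -lt0n.
have dF (x : R) : is_derive x 1 (fun x => m%:R^-1 * sin (m%:R * x)) (cos (m%:R * x)).
  by apply: is_derive_eq; rewrite /GRing.scale /=; field.
rewrite (Rintegral_derive (pi_gt0 R) _ dF); last first.
  by move=> x; apply: continuous_comp; [exact: continuous_scale|exact: continuous_cos].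
rewrite !mulr0 sin0 mulr0 subr0 mulr_natl.
suff -> : sin (pi *+ m) = 0 :> R by rewrite mulr0.
elim: m {m0 mR dF} => [|m IH]; first by rewrite mulr0n sin0.
by rewrite mulrS addrC sinDpi IH oppr0.
Qed.

Lemma Rintegral_sin_sin (k : nat) :
  \int[lam]_(x in `[0, pi]) (sin x * sin (k.+1%:R * x)) = (pi / 2) *+ (k == 0)%N.
Proof.
have cC (c : R) : continuous (fun x : R => cos (c * x)).
  by move=> x; apply: continuous_comp; [exact: continuous_scale|exact: continuous_cos].
have iC c : lam.-integrable `[0, pi] (EFin \o (fun x : R => cos (c * x))).
  exact: continuous_integrable_itv.
have -> : (fun x : R => sin x * sin (k.+1%:R * x)) =
    (fun x => 2^-1 * cos (k%:R * x) + (- 2^-1) * cos (k.+2%:R * x)).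
  apply/funext => x.
  have -> : k%:R * x = k.+1%:R * x - x by rewrite -(natr1 k); ring.
  have -> : k.+2%:R * x = k.+1%:R * x + x by rewrite -(natr1 k.+1); ring.
  rewrite cosB cosD; lra.
rewrite RintegralD//; [|exact: RintegrableZ|exact: RintegrableZ].
rewrite !RintegralZl// (Rintegral_cos_mul (m := k.+2))// mulr0 addr0.
case: k => [|k]; last by rewrite Rintegral_cos_mul// mulr0.
under eq_Rintegral do rewrite mul0r cos0.
rewrite Rintegral_cst//= lebesgue_measure_itv/= lte_fin pi_gt0 /= subr0; lra.
Qed.

End calculus.

(** * The Cauchy transform of the semicircle law *)

Section semicircle_finite.
Context {R : realType}.
Local Notation lam := (@lebesgue_measure R).

Lemma semicircle_pdf_ge0 (x : R) : 0 <= semicircle_pdf x.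
Proof. by rewrite mulr_ge0 ?sqrtr_ge0// invr_ge0 mulr_ge0// pi_ge0. Qed.

Lemma continuous_semicircle_pdf : continuous (@semicircle_pdf R).
Proof.
move=> x; apply: cvgM; first exact: cvg_cst.
apply: (@continuous_comp _ _ _ (fun x : R => 4 - x ^+ 2) Num.sqrt);
  last exact: sqrt_continuous.
by apply: cvgB; [exact: cvg_cst | exact: exprn_continuous].
Qed.

Lemma semicircle_pdf_out (x : R) : ~~ (x \in `[(-2)%R, 2%R]) -> semicircle_pdf x = 0.
Proof.
rewrite in_itv /= => xI; rewrite /semicircle_pdf ler0_sqrtr ?mulr0//.
by rewrite leNgt; apply: contra xI => h; nra.
Qed.

Lemma semicircle_fin_num : fin_num_fun (@semicircle R).
Proof.
apply: lty_fin_num_fun; rewrite /= /semicircle.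
have -> : (\int[lam]_x (semicircle_pdf x)%:E =
    \int[lam]_(x in `[(-2)%R, 2%R]) (semicircle_pdf x)%:E)%E.
  rewrite [RHS]integral_mkcond; apply: eq_integral => x _.
  by rewrite patchE mem_setE; case: ifPn => // /semicircle_pdf_out ->.
have /integrableP[_] := continuous_integrable_itv (-2) 2 continuous_semicircle_pdf.
under eq_integral do rewrite /= ger0_norm ?semicircle_pdf_ge0//.
by [].
Qed.

End semicircle_finite.

Section semicircle_borel.
Context {R : realType}.
Local Notation lam := (@lebesgue_measure R).

(** The real line carries its Borel $\sigma$-algebra in two guises, with the
    semicircle law on one and the Lebesgue measure on the other; the identity
    map transports the semicircle law to the second. *)
Definition borel_id : R -> measurableTypeR R := idfun.

Lemma measurable_borel_id : measurable_fun setT borel_id.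
Proof. by move=> _ A mA; rewrite setTI. Qed.

HB.instance Definition _ :=
  isMeasurableFun.Build _ _ _ _ borel_id measurable_borel_id.

Definition semicircle_borel (A : set (measurableTypeR R)) : \bar R := semicircle A.

Let semicircle_borel0 : semicircle_borel set0 = 0%E.
Proof. exact: (measure0 (@semicircle R)). Qed.

Let semicircle_borel_ge0 A : (0 <= semicircle_borel A)%E.
Proof. exact: (measure_ge0 (@semicircle R)). Qed.

Let semicircle_borel_sigma_additive : semi_sigma_additive semicircle_borel.
Proof. exact: (@measure_semi_sigma_additive _ _ _ (@semicircle R)). Qed.

HB.instance Definition _ := isMeasure.Build _ _ _ semicircle_borel
  semicircle_borel0 semicircle_borel_ge0 semicircle_borel_sigma_additive.

Let semicircle_borel_fin : fin_num_fun semicircle_borel.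
Proof. by move=> A mA; exact: semicircle_fin_num. Qed.

HB.instance Definition _ :=
  Measure_isFinite.Build _ _ _ semicircle_borel semicircle_borel_fin.

(** Substitution $x = 2\cos t$; the density at $2\cos t$ is $\sin t/\pi$ and the
    Jacobian is $2\sin t$. *)
Lemma Rintegral_semicircle (f : R -> R) : continuous f ->
  (@semicircle R).-integrable setT (EFin \o f) ->
  \int[semicircle]_x f x =
  2 / pi * \int[lam]_(t in `[0, pi]) (f (2 * cos t) * sin t ^+ 2).
Proof.
move=> cf fi; have cp := continuous_semicircle_pdf.
have -> : \int[semicircle]_x f x = \int[lam]_x (f x * semicircle_pdf x).
  have mf : measurable_fun setT (EFin \o f).
    by apply/measurable_EFinP; exact: continuous_measurable_fun.
  transitivity (\int[semicircle_borel]_x f x).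
    rewrite /Rintegral; congr fine; symmetry.
    transitivity (\int[pushforward (@semicircle R) borel_id]_x (f x)%:E)%E.
      by apply: eq_measure_integral => A mA _.
    exact: (integral_pushforward measurable_borel_id mf fi).
  apply: (@integral_density _ (measurableTypeR R) R semicircle_borel lam).
  - exact: continuous_measurable_fun.
  - by [].
  - have := integrable_pushforward measurable_borel_id mf fi measurableT.
    move=> /integrableP[_ h]; apply/integrableP; split=> //.
have cfp : continuous (fun x => f x * semicircle_pdf x).
  by move=> x; apply: cvgM; [exact: cf|exact: cp].
have ccos : continuous (fun t : R => 2 * cos t).
  by move=> x; apply: cvgM; [exact: cvg_cst|exact: continuous_cos].
have csin : continuous (fun t : R => (- 2) * sin t).
  by move=> x; apply: cvgM; [exact: cvg_cst|exact: continuous_sin].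
have dcos (x : R) : is_derive x 1 (fun t : R => 2 * cos t) (- 2 * sin x).
  by apply: is_derive_eq; rewrite /GRing.scale /=; ring.
have dE : derive1 (fun t : R => 2 * cos t) = (fun t => - 2 * sin t).
  by apply/funext => x; rewrite derive1E; have [] := dcos x.
have -> : \int[lam]_x (f x * semicircle_pdf x) =
    \int[lam]_(x in `[2 * cos pi, 2 * cos 0]) (f x * semicircle_pdf x).
  rewrite cospi cos0 mulr1 mulrN1 [RHS]Rintegral_mkcond; apply: eq_Rintegral => x _.
  by rewrite patchE mem_setE; case: ifPn => // /semicircle_pdf_out ->; rewrite mulr0.
rewrite -RintegralZl//; last first.
  apply: continuous_integrable_itv => x; apply: cvgM.
    by apply: continuous_comp; [exact: ccos|exact: cf].
  by apply: (@continuous_comp _ _ _ sin (fun x : R => x ^+ 2));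
    [exact: continuous_sin|exact: exprn_continuous].
rewrite /Rintegral (@integration_by_substitution_decreasing _
  (fun t : R => 2 * cos t) (fun x => f x * semicircle_pdf x)) ?pi_ge0//; last 6 first.
- move=> x y xI yI xy /=; rewrite ltr_pM2l//.
  by rewrite ltr_cos.
- by rewrite dE => x _; exact: csin.
- by rewrite dE; apply/cvg_ex; exists (- 2 * sin 0); exact/cvg_at_right_filter/csin.
- by rewrite dE; apply/cvg_ex; exists (- 2 * sin pi); exact/cvg_at_left_filter/csin.
- by apply: derivable_LRcontinuous => x; have [] := dcos x.
- exact: continuous_subspaceT.
congr fine; apply: eq_integral => x; rewrite inE /= in_itv /= => xI.
have s0 : 0 <= sin x by exact: sin_ge0_pi.
transitivity (f (2 * cos x) * semicircle_pdf (2 * cos x) * - (- 2 * sin x))%:E.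
  by rewrite dE.
rewrite /semicircle_pdf; congr (_%:E).
have -> : 4 - (2 * cos x) ^+ 2 = (2 * sin x) ^+ 2.
  by rewrite !exprMn cos2sin2; ring.
rewrite sqrtr_sqr ger0_norm ?mulr_ge0//.
by have := lt0r_neq0 (pi_gt0 R); generalize (@pi R) => p p0; field.
Qed.

End semicircle_borel.

Section joukowski.
Context {R : realType}.

(** The roots of $g^2 - zg + 1$ are inverse to each other and not real, so one
    of them lies in the lower half-plane; there
    $\Im z = -\Im g\,(|g|^{-2} - 1)$ forces $|g| < 1$. *)
Lemma joukowski_lower_inverse (z : R[i]) : 0 < Im z ->
  exists g : R[i], [/\ g != 0, g + g^-1 = z, Im g < 0 & normc g < 1].
Proof.
move=> z0; pose s := sqrtc (z ^+ 2 - 4); pose g := (z + s) / 2.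
have g_eq : g * (z - g) = 1.
  by rewrite /g; have := sqr_sqrtc (z ^+ 2 - 4); rewrite -/s => ss; field: ss.
have g0 : g != 0.
  by apply/eqP => g0; move/eqP: g_eq; rewrite g0 mul0r eq_sym oner_eq0.
have gV : g^-1 = z - g by apply: (mulfI g0); rewrite g_eq mulfV.
have sum (x : R[i]) : x != 0 -> Im x < 0 -> x + x^-1 = z -> normc x < 1.
  move=> x0 ix xz; have := congr1 (@complex.Im R) xz; rewrite cImD cImV => e.
  have nx : 0 < normc x ^+ 2 by rewrite exprn_gt0// normc_gt0.
  have e2 : - Im x * (1 - normc x ^+ 2) = Im z * normc x ^+ 2.
    by rewrite -e; field; rewrite gt_eqF// normc_gt0.
  have : 0 < 1 - normc x ^+ 2.
    by rewrite -(@pmulr_rgt0 _ (- Im x)) ?oppr_gt0// e2 mulr_gt0.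
  rewrite subr_gt0 => lt1.
  by rewrite -(@ltr_pXn2r _ 2) ?nnegrE ?normc_ge0// expr1n.
have [gi|gi|gi] := ltgtP (Im g) 0.
- exists g; split => //; first by rewrite gV addrC subrK.
  by apply: sum => //; rewrite gV addrC subrK.
- exists g^-1.
  have gi' : Im g^-1 < 0 by rewrite cImV oppr_lt0 divr_gt0// exprn_gt0// normc_gt0.
  have eqz : g^-1 + g^-1^-1 = z by rewrite invrK gV subrK.
  by split => //; [rewrite invr_eq0|apply: sum => //; rewrite invr_eq0].
- exfalso; move: z0; have -> : z = g + g^-1 by rewrite gV addrC subrK.
  by rewrite cImD cImV gi mul0r oppr0 addr0 ltxx.
Qed.

End joukowski.

Section semicircle_transform.
Context {R : realType}.
Local Notation lam := (@lebesgue_measure R).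
Variable z : R[i].
Hypothesis z0 : 0 < Im z.

Let kernel (x : R) : R[i] := (z - x%:C)^-1.

Let Imk x : Im (z - x%:C) = Im z. Proof. by rewrite cImD cImN /= subr0. Qed.
Let Rek x : Re (z - x%:C) = Re z - x. Proof. by rewrite cReD cReN. Qed.

Let kn0 x : z - x%:C != 0. Proof. by apply: neq0_Im; rewrite Imk. Qed.

Let sqk x : normc (z - x%:C) ^+ 2 = (Re z - x) ^+ 2 + Im z ^+ 2.
Proof. by rewrite sqr_normcE Imk Rek. Qed.

Let sqk0 x : 0 < (Re z - x) ^+ 2 + Im z ^+ 2.
Proof. by rewrite ltr_wpDl ?sqr_ge0// exprn_gt0. Qed.

Let kernel_le x : normc (kernel x) <= (Im z)^-1.
Proof.
rewrite normcV lef_pV2 ?posrE ?normc_gt0//.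
by rewrite (le_trans _ (normIm_le _))// Imk ler_norm.
Qed.

Let cinv : continuous (fun x : R => ((Re z - x) ^+ 2 + Im z ^+ 2)^-1).
Proof.
move=> t; apply: cvgV; first by rewrite gt_eqF.
apply: cvgD; last exact: cvg_cst.
apply: (@continuous_comp _ _ _ (fun t => Re z - t) (fun x => x ^+ 2)).
  by apply: cvgB; [exact: cvg_cst|exact: cvg_id].
exact: exprn_continuous.
Qed.

Let cRek : continuous (fun x => Re (kernel x)).
Proof.
have -> : (fun x => Re (kernel x)) =
    (fun x => (Re z - x) * ((Re z - x) ^+ 2 + Im z ^+ 2)^-1).
  by apply/funext => t; rewrite /kernel cReV sqk Rek.
move=> t; apply: cvgM; last exact: cinv.
by apply: cvgB; [exact: cvg_cst|exact: cvg_id].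
Qed.

Let cImk : continuous (fun x => Im (kernel x)).
Proof.
have -> : (fun x => Im (kernel x)) =
    (fun x => (- Im z) * ((Re z - x) ^+ 2 + Im z ^+ 2)^-1).
  by apply/funext => t; rewrite /kernel cImV sqk Imk mulNr.
by move=> t; apply: cvgM; [exact: cvg_cst|exact: cinv].
Qed.

Let iker (k : R -> R) : continuous k -> (forall x, `|k x| <= normc (kernel x)) ->
  (@semicircle R).-integrable setT (EFin \o k).
Proof.
move=> ck kb; apply: measurable_bounded_integrable => //.
- exact: fin_num_fun_lty semicircle_fin_num.
- exact: continuous_measurable_fun.
- exists (Im z)^-1; split; first exact: num_real.
  move=> M zM t _; apply: le_trans (ltW zM).
  exact: le_trans (kb _) (kernel_le _).
Qed.

(* c k is pi / 2 times the integral of U_(k-1)(x/2) / (z - x) against the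
   semicircle law, in the variable x = 2 cos t *)
Let fk (k : nat) (t : R) : R[i] := (sin t * sin (k%:R * t))%:C * kernel (2 * cos t).
Let c (k : nat) : R[i] := Cintegral lam `[0, pi] (fk k).

Let csin k : continuous (fun t : R => sin t * sin (k%:R * t)).
Proof.
move=> t; apply: cvgM; first exact: continuous_sin.
by apply: continuous_comp; [exact: continuous_scale|exact: continuous_sin].
Qed.

Let ccos : continuous (fun t : R => 2 * cos t).
Proof. by move=> x; apply: cvgM; [exact: cvg_cst|exact: continuous_cos]. Qed.

Let ifk k : Cintegrable lam `[0, pi] (fk k).
Proof.
split.
- have -> : (fun t => Re (fk k t)) =
      (fun t => (sin t * sin (k%:R * t)) * Re (kernel (2 * cos t))).
    by apply/funext => t; rewrite cReM/= mul0r subr0.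
  have cc : continuous (fun t => Re (kernel (2 * cos t))).
    move=> t; apply: (@continuous_comp _ _ _ (fun t : R => 2 * cos t)
      (fun x : R => Re (kernel x))); [exact: ccos|exact: cRek].
  by apply: continuous_integrable_itv => t; apply: cvgM; [exact: csin|exact: cc].
- have -> : (fun t => Im (fk k t)) =
      (fun t => (sin t * sin (k%:R * t)) * Im (kernel (2 * cos t))).
    by apply/funext => t; rewrite cImM/= mul0r addr0.
  have cc : continuous (fun t => Im (kernel (2 * cos t))).
    move=> t; apply: (@continuous_comp _ _ _ (fun t : R => 2 * cos t)
      (fun x : R => Im (kernel x))); [exact: ccos|exact: cImk].
  by apply: continuous_integrable_itv => t; apply: cvgM; [exact: csin|exact: cc].
Qed.

Let semicircleE : cauchy_transform semicircle z = (2 / pi)%:C * c 1.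
Proof.
have e (k : R[i] -> R) : (forall a y, k (a%:C * y) = a * k y) ->
    continuous (fun x => k (kernel x)) -> (forall y, `|k y| <= normc y) ->
    \int[semicircle]_x k (kernel x) =
    2 / pi * \int[lam]_(t in `[0, pi]) k (fk 1 t).
  move=> kZ ck kb; rewrite Rintegral_semicircle//; last exact: iker.
  congr (_ * _); apply: eq_Rintegral => t _.
  by rewrite /fk kZ mul1r -expr2 mulrC.
apply: complex_eqP.
- rewrite cReM /= mul0r subr0; apply: e => //; last exact: normRe_le.
  by move=> a y; rewrite cReM /= mul0r subr0.
- rewrite cImM /= mul0r addr0; apply: e => //; last exact: normIm_le.
  by move=> a y; rewrite cImM /= mul0r addr0.
Qed.

Let c0 : c 0 = 0.
Proof.
rewrite /c (_ : fk 0 = fun=> 0); last first.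
  by apply/funext => t; rewrite /fk mul0r sin0 mulr0 rmorph0 mul0r.
by apply: complex_eqP; rewrite /Cintegral /= Rintegral_cst// mul0r.
Qed.

(** $2\cos t\,\sin kt = \sin(k+1)t + \sin(k-1)t$ gives a three-term recurrence
    whose characteristic equation is $x^2 - zx + 1 = 0$. *)
Let c_rec k : c k.+2 + c k = z * c k.+1 - ((pi / 2) *+ (k == 0)%N)%:C.
Proof.
have isin : lam.-integrable `[0, pi] (EFin \o (fun t : R => sin t * sin (k.+1%:R * t))).
  exact: continuous_integrable_itv.
rewrite -(Rintegral_sin_sin k) -CintegralR// /c -CintegralD//.
rewrite -CintegralZ// -CintegralB//; [|exact: CintegrableZ|exact: CintegrableR].
congr Cintegral; apply/funext => t; rewrite /fk.
have e2 : sin (k.+2%:R * t) + sin (k%:R * t) = 2 * cos t * sin (k.+1%:R * t).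
  have -> : k%:R * t = k.+1%:R * t - t by rewrite -(natr1 k); ring.
  have -> : k.+2%:R * t = k.+1%:R * t + t by rewrite -(natr1 k.+1); ring.
  by rewrite sinB sinD; ring.
rewrite -mulrDl -rmorphD /= -mulrDr e2.
set x := 2 * cos t; set y := sin t * _.
have -> : sin t * (x * sin (k.+1%:R * t)) = y * x by rewrite /y; ring.
rewrite rmorphM /= (_ : z * _ - _ = y%:C * (z * kernel x - 1)); last by ring.
rewrite -mulrA; congr (_ * _).
by rewrite -(mulVf (kn0 x)) /kernel; ring.
Qed.

Let c_le k : normc (c k) <= 2 * ((Im z)^-1 * pi).
Proof.
have icst : lam.-integrable `[0, pi] (EFin \o (fun _ : R => (Im z)^-1)).
  by apply: continuous_integrable_itv => t; exact: cvg_cst.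
apply: le_trans (le_normc_Cintegral _ (ifk k) icst _) _ => //.
  move=> t _; rewrite normcM normcR -[leRHS]mul1r ler_pM ?normc_ge0//.
  by rewrite normrM mulr_ile1// sin_max.
by rewrite Rintegral_cst//= lebesgue_measure_itv/= lte_fin pi_gt0 /= subr0.
Qed.

(** The sequence $c_{k+1} - g c_k$ is multiplied by $1/g$ at each step of the
    recurrence and bounded, hence zero because $|g| < 1$. Its first term gives
    $c_1 = (\pi/2)\,g$. *)
Lemma semicircle_cauchy_transform :
  let g := cauchy_transform semicircle z in g + g^-1 = z /\ Im g < 0.
Proof.
have [g [g0 gz gi g1]] := joukowski_lower_inverse z0.
suff -> : cauchy_transform semicircle z = g by [].
pose e k := c k.+2 - g * c k.+1.
have e_rec k : e k = g * e k.+1.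
  have := c_rec k.+1; rewrite mulr0n rmorph0 subr0 => h.
  have -> : e k.+1 = g^-1 * c k.+2 - c k.+1.
    rewrite /e (_ : c k.+3 = z * c k.+2 - c k.+1); last by rewrite -h addrK.
    by rewrite -gz; ring.
  by rewrite /e mulrBr mulVKf.
have e_pow k : e 0%N = g ^+ k * e k.
  by elim: k => [|k ->]; [rewrite expr0 mul1r|rewrite (e_rec k) exprS; ring].
set B := 2 * ((Im z)^-1 * pi).
have e_le k : normc (e 0%N) <= 2 * B * normc g ^+ k.
  rewrite (e_pow k) normcM normcX mulrC ler_wpM2r ?exprn_ge0 ?normc_ge0//.
  apply: le_trans (le_normcB _ _) _; rewrite mulr_natl mulr2n lerD ?c_le//.
  rewrite normcM -[leRHS]mul1r ler_pM ?normc_ge0// ?c_le//; exact: ltW.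
have e0 : e 0%N = 0.
  apply: eq0_normc; apply/eqP; rewrite eq_le normc_ge0 andbT.
  have cg : (fun k => 2 * B * normc g ^+ k) @ \oo --> (0 : R).
    by apply: (@cvg_geometric R); rewrite ger0_norm ?normc_ge0.
  have := limr_ge (cvgP _ cg) (nearW _ e_le).
  by rewrite (cvg_lim (@Rhausdorff R) cg); apply; exact: eventually_filter.
have := c_rec 0; rewrite c0 addr0 eqxx mulr1n => h.
have c1E : c 1 = (pi / 2)%:C * g.
  have : g^-1 * c 1 = (pi / 2)%:C.
    have h2 : c 2 = g * c 1 by apply/eqP; rewrite -subr_eq0 -/(e 0%N) e0.
    have -> : (pi / 2)%:C = z * c 1 - c 2 by rewrite h; ring.
    by rewrite h2 -gz; ring.
  by move=> <-; rewrite mulrAC mulVf// mul1r.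
rewrite semicircleE c1E mulrA -rmorphM /=.
have := lt0r_neq0 (pi_gt0 R); generalize (@pi R) => p p0.
by rewrite (_ : 2 / p * (p / 2) = 1) ?mul1r//; field.
Qed.

End semicircle_transform.

(** * Reflections and moments on the sphere *)

Section plane_reflection.
Context {R : realType} (n : nat).
Implicit Types (i j a b : 'I_n) (x : n.-tuple R).

(** The Hadamard reflection for $c = s = 1/\sqrt2$, and the change of sign of
    the coordinate $i$ for $c = -1$, $s = 0$. *)
Definition plane_reflection i j (c s : R) : 'M[R]_n :=
  \matrix_(a, b) (if a == i then c * (b == i)%:R + s * (b == j)%:R
                  else if a == j then s * (b == i)%:R - c * (b == j)%:R
                  else (b == a)%:R).

Let sum_delta (f : 'I_n -> R) a : \sum_(b < n) (b == a)%:R * f b = f a.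
Proof.
rewrite (bigD1 a)//= eqxx mul1r big1 ?addr0// => b /negPf ->.
by rewrite mul0r.
Qed.

Let sum_plane_reflection i j c s (f : 'I_n -> R) a :
  \sum_(b < n) plane_reflection i j c s a b * f b =
  if a == i then c * f i + s * f j
  else if a == j then s * f i - c * f j else f a.
Proof.
under eq_bigr do rewrite mxE.
case: ifP => _; [|case: ifP => _]; last exact: sum_delta.
- under eq_bigr do rewrite mulrDl -!mulrA.
  by rewrite big_split/= -!mulr_sumr !sum_delta.
- under eq_bigr do rewrite mulrBl -!mulrA.
  by rewrite sumrB/= -!mulr_sumr !sum_delta.
Qed.

Lemma plane_reflection_orthogonal i j c s : i != j -> c ^+ 2 + s ^+ 2 = 1 ->
  plane_reflection i j c s *m (plane_reflection i j c s)^T = 1%:M.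
Proof.
move=> ij cs; apply/matrixP => a b; rewrite !mxE.
under eq_bigr do rewrite [X in _ * X]mxE.
rewrite sum_plane_reflection !mxE.
have ij' := negPf ij; have ji' : (j == i) = false by rewrite eq_sym.
have neq (p q : 'I_n) : p != q -> ((p == q) = false) * ((q == p) = false).
  by move=> pq; rewrite (eq_sym q) (negPf pq).
have [ai|/neq ai] := eqVneq a i; have [bi|/neq bi] := eqVneq b i;
  rewrite ?ai ?bi ?eqxx ?ij' ?ji' ?ai ?bi ?mulr1n ?mulr0n.
- by rewrite -[RHS]cs; ring.
- by have [bj|/neq bj] := eqVneq b j; rewrite ?bj ?eqxx ?ij' ?ji' ?bi ?bj ?mulr1n ?mulr0n; ring.
- by have [aj|/neq aj] := eqVneq a j; rewrite ?aj ?eqxx ?ij' ?ji' ?ai ?aj ?mulr1n ?mulr0n; ring.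
have [aj|/neq aj] := eqVneq a j; have [bj|/neq bj] := eqVneq b j;
  rewrite ?aj ?bj ?eqxx ?ij' ?ji' ?ai ?aj ?bi ?bj ?mulr1n ?mulr0n.
- by rewrite -[RHS]cs; ring.
- ring.
- ring.
by rewrite eq_sym.
Qed.

Lemma tnth_plane_reflection i j c s x a :
  tnth (mx_act (plane_reflection i j c s) x) a =
  if a == i then c * tnth x i + s * tnth x j
  else if a == j then s * tnth x i - c * tnth x j else tnth x a.
Proof. by rewrite tnth_mktuple sum_plane_reflection. Qed.

End plane_reflection.

Section sphere_integral.
Context {R : realType} (n : nat) (sigma : probability (n.-tuple R) R).
Hypothesis sigma_unif : is_uniform_on_sphere sigma.
Implicit Types (i j : 'I_n) (x : n.-tuple R) (f g : n.-tuple R -> R).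
Local Notation S := (@unit_sphere R n).

Lemma measurable_coordX i k : measurable_fun setT (fun x : n.-tuple R => tnth x i ^+ k).
Proof. by apply: measurable_funX; exact: measurable_tnth. Qed.

Lemma measurable_unit_sphere : measurable S.
Proof.
have mf : measurable_fun setT (fun x : n.-tuple R => \sum_(i < n) tnth x i ^+ 2).
  by apply: measurable_sum => i; exact: measurable_coordX.
have -> : S = setT `&` (fun x : n.-tuple R => \sum_(i < n) tnth x i ^+ 2) @^-1` [set 1].
  by rewrite setTI.
exact: mf.
Qed.

Lemma sphere_coord_le1 x i : S x -> `|tnth x i| <= 1.
Proof.
move=> Sx; rewrite -(@ler_pXn2r _ 2) ?nnegrE// real_normK ?num_real// expr1n -Sx.
by rewrite (bigD1 i)//= lerDl sumr_ge0// => j _; rewrite sqr_ge0.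
Qed.

Lemma sphere_integrable f (B : R) : measurable_fun setT f ->
  (forall x, S x -> `|f x| <= B) -> sigma.-integrable S (EFin \o f).
Proof.
move=> mf fB; apply: measurable_bounded_integrable.
- exact: measurable_unit_sphere.
- apply: (@le_lt_trans _ _ 1%E); last exact: ltry.
  by rewrite probability_le1//; exact: measurable_unit_sphere.
- exact: measurable_funTS.
- exists B; split; first exact: num_real.
  by move=> M BM x Sx; apply: le_trans (ltW BM); exact: fB.
Qed.

Lemma measurable_mx_act (M : 'M[R]_n) : measurable_fun setT (mx_act M).
Proof.
apply/measurable_fun_tnthP => i.
rewrite (_ : _ \o _ = fun x => \sum_(j < n) M i j * tnth x j); last first.
  by apply/funext => x /=; rewrite tnth_mktuple.
apply: measurable_sum => j; apply: measurable_funM => //; exact: measurable_tnth.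
Qed.

Lemma sphere_preimage (M : 'M[R]_n) : M *m M^T = 1%:M -> mx_act M @^-1` S = S.
Proof.
move=> MM; have MM' : M^T *m M = 1%:M by exact: mulmx1C.
suff e x : \sum_(i < n) tnth (mx_act M x) i ^+ 2 = \sum_(i < n) tnth x i ^+ 2.
  by apply/seteqP; split => x /=; rewrite /unit_sphere /= e.
pose v : 'cV[R]_n := \col_i tnth x i.
have e1 : \sum_(i < n) tnth x i ^+ 2 = (v^T *m v) 0 0.
  by rewrite mxE; apply: eq_bigr => i _; rewrite !mxE -expr2.
have e2 : \sum_(i < n) tnth (mx_act M x) i ^+ 2 = ((M *m v)^T *m (M *m v)) 0 0.
  rewrite [RHS]mxE; apply: eq_bigr => i _; rewrite [X in X * _]mxE -expr2.
  congr (_ ^+ 2); rewrite tnth_mktuple mxE.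
  by apply: eq_bigr => j _; rewrite mxE.
by rewrite e1 e2 trmx_mul mulmxA -(mulmxA v^T) MM' mulmx1.
Qed.

(** An orthogonal matrix preserves both the measure and the sphere. *)
Lemma sphere_integral_invariant (M : 'M[R]_n) f (B : R) : M *m M^T = 1%:M ->
  measurable_fun setT f -> (forall x, S x -> `|f x| <= B) ->
  \int[sigma]_(x in S) f (mx_act M x) = \int[sigma]_(x in S) f x.
Proof.
move=> MM mf fB; have mS := measurable_unit_sphere.
have mM := measurable_mx_act M.
have pS := sphere_preimage MM.
have iM : sigma.-integrable (mx_act M @^-1` S) ((EFin \o f) \o mx_act M).
  rewrite pS; apply: (@sphere_integrable (f \o mx_act M) B).
    exact: measurableT_comp.
  by move=> x Sx; apply: fB; rewrite -pS in Sx.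
have mf' : measurable_fun setT (EFin \o f) by exact/measurable_EFinP.
rewrite /Rintegral; congr fine.
transitivity (\int[pushforward sigma (mx_act M)]_(x in S) (f x)%:E)%E.
  by rewrite (integral_pushforward mM mf' iM)// pS.
apply: eq_measure_integral => A mA _.
exact: sigma_unif.2 MM _ mA.
Qed.


Let mixed_le1 i j k l x : S x -> `|tnth x i ^+ k * tnth x j ^+ l| <= 1.
Proof.
by move=> Sx; rewrite normrM !normrX mulr_ile1// exprn_ile1// sphere_coord_le1.
Qed.

Let imixed i j k l :
  sigma.-integrable S (EFin \o (fun x => tnth x i ^+ k * tnth x j ^+ l)).
Proof.
apply: (@sphere_integrable _ 1); last exact: mixed_le1.
by apply: measurable_funM; exact: measurable_coordX.
Qed.

Let icoord i k : sigma.-integrable S (EFin \o (fun x => tnth x i ^+ k)).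
Proof.
have := imixed i i k 0; apply: eq_integrable; first exact: measurable_unit_sphere.
by move=> x _ /=; rewrite expr0 mulr1.
Qed.

Let mS := measurable_unit_sphere.

(** The Hadamard reflection in the plane $(i,j)$ preserves the mean of
    $x_i^{2k+2}+x_j^{2k+2}$, and by hypothesis it maps this polynomial to at most half
    of itself plus mixed terms; the half is absorbed by the left-hand side. *)
Lemma sphere_moment_pair k :
  (forall a b : R, ((a + b) ^+ (2 * k.+1) + (a - b) ^+ (2 * k.+1)) / 2 ^+ k.+1 <=
     (a ^+ (2 * k.+1) + b ^+ (2 * k.+1)) / 2 +
     8 * (a ^+ (2 * k) * b ^+ 2 + b ^+ (2 * k) * a ^+ 2)) ->
  forall i j,
  \int[sigma]_(x in S) (tnth x i ^+ (2 * k.+1)) +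
  \int[sigma]_(x in S) (tnth x j ^+ (2 * k.+1)) <=
  16 * (\int[sigma]_(x in S) (tnth x i ^+ (2 * k) * tnth x j ^+ 2) +
        \int[sigma]_(x in S) (tnth x j ^+ (2 * k) * tnth x i ^+ 2)).
Proof.
move=> hk i j; have [->|ij] := eqVneq i j.
  have e : (fun x : n.-tuple R => tnth x j ^+ (2 * k) * tnth x j ^+ 2) =
           (fun x => tnth x j ^+ (2 * k.+1)).
    by apply/funext => x; rewrite -exprD -mulnSr.
  rewrite e; have : 0 <= \int[sigma]_(x in S) (tnth x j ^+ (2 * k.+1)).
    by apply: Rintegral_ge0 => x _; rewrite exprM exprn_ge0// sqr_ge0.
  lra.
pose r : R := (Num.sqrt 2)^-1.
have r2 : r ^+ 2 = 2^-1 by rewrite exprVn sqr_sqrtr.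
pose H := plane_reflection i j r r.
have HH : H *m H^T = 1%:M.
  by apply: plane_reflection_orthogonal => //; rewrite r2; lra.
pose f (x : n.-tuple R) := tnth x i ^+ (2 * k.+1) + tnth x j ^+ (2 * k.+1).
pose g (x : n.-tuple R) := tnth x i ^+ (2 * k) * tnth x j ^+ 2 +
  tnth x j ^+ (2 * k) * tnth x i ^+ 2.
have mf : measurable_fun setT f by apply: measurable_funD; exact: measurable_coordX.
have fB x : S x -> `|f x| <= 2.
  move=> Sx; apply: le_trans (ler_normD _ _) _; rewrite !normrX.
  have := sphere_coord_le1 i Sx; have := sphere_coord_le1 j Sx => hj hi.
  have := exprn_ile1 (2 * k.+1) (normr_ge0 _) hi.
  have := exprn_ile1 (2 * k.+1) (normr_ge0 _) hj; lra.
have fi : sigma.-integrable S (EFin \o f) := sphere_integrable mf fB.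
have gi : sigma.-integrable S (EFin \o g) by apply: RintegrableD.
have ji : j == i = false by rewrite eq_sym (negPf ij).
have fH x : f (mx_act H x) <= 2^-1 * f x + 8 * g x.
  rewrite /f !tnth_plane_reflection eqxx ji eqxx -mulrDr -mulrBr !exprMn.
  rewrite -mulrDr exprM r2 exprVn mulrC.
  by apply: le_trans (hk _ _) _; rewrite /g; lra.
have : \int[sigma]_(x in S) f (mx_act H x) <=
    \int[sigma]_(x in S) (2^-1 * f x + 8 * g x).
  apply: le_Rintegral => //.
  - have pS := sphere_preimage HH.
    apply: (@sphere_integrable (f \o mx_act H) 2).
      by apply: measurableT_comp => //; exact: measurable_mx_act.
    by move=> x Sx; apply: fB; rewrite -pS in Sx.
  - by apply: RintegrableD => //; exact: RintegrableZ.
rewrite (sphere_integral_invariant HH mf fB).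
rewrite [leRHS]RintegralD; [|exact: mS|exact: RintegrableZ|exact: RintegrableZ].
rewrite !RintegralZl// /f /g !RintegralD//; lra.
Qed.

Definition sphere_moment k : R := \sum_(i < n) \int[sigma]_(x in S) (tnth x i ^+ (2 * k)).

Let sphere_mass : \int[sigma]_(x in S) (1 : R) = 1.
Proof.
rewrite (Rintegral_cst sigma mS).
by rewrite mul1r -[RHS]/(fine 1%E); congr fine; exact: sigma_unif.1.
Qed.

Lemma Rintegral_sum (I : Type) (s : seq I) (F : I -> n.-tuple R -> R) :
  (forall l : I, sigma.-integrable S (EFin \o F l)) ->
  sigma.-integrable S (EFin \o (fun x => \sum_(l <- s) F l x)) /\
  \int[sigma]_(x in S) (\sum_(l <- s) F l x) =
  \sum_(l <- s) \int[sigma]_(x in S) F l x.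
Proof.
move=> Fi; elim: s => [|l s [IH1 IH2]].
  split.
    apply: eq_integrable (integrable0 sigma S); first exact: mS.
    by move=> x _ /=; rewrite big_nil.
  under eq_Rintegral do rewrite big_nil.
  by rewrite big_nil (Rintegral_cst sigma mS) mul0r.
have e : (fun x => \sum_(l <- l :: s) F l x) = (fun x => F l x + \sum_(l <- s) F l x).
  by apply/funext => x; rewrite big_cons.
rewrite e; split; first by apply: RintegrableD => //; exact: mS.
by rewrite RintegralD ?IH2 ?big_cons//; exact: mS.
Qed.

Lemma sphere_moment1 : sphere_moment 1 = 1.
Proof.
rewrite /sphere_moment -(Rintegral_sum _ (fun i => icoord i _)).2 -[RHS]sphere_mass.
by apply: eq_Rintegral => x; rewrite inE.
Qed.

(** Summing the pair estimate over all $i$ and $j$, the relation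
    $\sum_j x_j^2 = 1$ collapses the mixed moments to moments of degree $2k$. *)
Lemma sphere_moment_step k :
  (forall a b : R, ((a + b) ^+ (2 * k.+1) + (a - b) ^+ (2 * k.+1)) / 2 ^+ k.+1 <=
     (a ^+ (2 * k.+1) + b ^+ (2 * k.+1)) / 2 +
     8 * (a ^+ (2 * k) * b ^+ 2 + b ^+ (2 * k) * a ^+ 2)) ->
  n%:R * sphere_moment k.+1 <= 16 * sphere_moment k.
Proof.
move=> hk; pose m i := \int[sigma]_(x in S) (tnth x i ^+ (2 * k.+1)).
pose p i j := \int[sigma]_(x in S) (tnth x i ^+ (2 * k) * tnth x j ^+ 2).
have le1 : \sum_(i < n) \sum_(j < n) (m i + m j) <=
    \sum_(i < n) \sum_(j < n) (16 * (p i j + p j i)).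
  by apply: ler_sum => i _; apply: ler_sum => j _; exact: sphere_moment_pair.
have pE : \sum_(i < n) \sum_(j < n) p i j = sphere_moment k.
  apply: eq_bigr => i _; rewrite -(Rintegral_sum _ (fun j => imixed i j _ _)).2.
  apply: eq_Rintegral => x; rewrite inE => Sx.
  by rewrite -mulr_sumr Sx mulr1.
have pE' : \sum_(i < n) \sum_(j < n) p j i = sphere_moment k.
  by rewrite exchange_big.
have e1 : \sum_(i < n) \sum_(j < n) (m i + m j) = 2 * (n%:R * sphere_moment k.+1).
  under eq_bigr do rewrite big_split/= sumr_const card_ord -mulr_natl.
  rewrite big_split/= sumr_const card_ord -mulr_natl -mulr_sumr.
  by rewrite /sphere_moment /m; ring.
have e2 : \sum_(i < n) \sum_(j < n) (16 * (p i j + p j i)) = 32 * sphere_moment k.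
  under eq_bigr do rewrite -mulr_sumr big_split/=.
  by rewrite -mulr_sumr big_split/= pE pE'; lra.
by move: le1; rewrite e1 e2; lra.
Qed.

(** Changing the sign of the coordinate $i$ shows that $x_i^3x_j^3$ has mean
    zero, so only the diagonal of the square survives. *)
Lemma sphere_cube_sum_sqr :
  \int[sigma]_(x in S) ((\sum_(i < n) tnth x i ^+ 3) ^+ 2) = sphere_moment 3.
Proof.
have e : (fun x : n.-tuple R => (\sum_(i < n) tnth x i ^+ 3) ^+ 2) =
  (fun x => \sum_(i < n) \sum_(j < n) (tnth x i ^+ 3 * tnth x j ^+ 3)).
  apply/funext => x; rewrite expr2 mulr_suml; apply: eq_bigr => i _.
  by rewrite mulr_sumr.
rewrite e (Rintegral_sum _ (fun i => (Rintegral_sum _ (fun j => imixed i j 3 3)).1)).2.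
apply: eq_bigr => i _; rewrite (Rintegral_sum _ (fun j => imixed i j 3 3)).2.
rewrite (bigD1 i)//= big1 ?addr0.
  by apply: eq_Rintegral => x _; rewrite -exprD.
move=> j ji; have ij : i != j by rewrite eq_sym.
pose H : 'M[R]_n := plane_reflection i j (-1) 0.
have FF : H *m H^T = 1%:M.
  by apply: plane_reflection_orthogonal; [exact: ij | ring].
have mf : measurable_fun setT (fun x : n.-tuple R => tnth x i ^+ 3 * tnth x j ^+ 3).
  by apply: measurable_funM; exact: measurable_coordX.
have := sphere_integral_invariant FF mf (fun x Sx => mixed_le1 i j 3 3 Sx).
have -> : (fun x => tnth (mx_act H x) i ^+ 3 * tnth (mx_act H x) j ^+ 3) =
    (fun x => (-1) * (tnth x i ^+ 3 * tnth x j ^+ 3)).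
  by apply/funext => x; rewrite !tnth_plane_reflection eqxx (negPf ji) eqxx; ring.
rewrite RintegralZl//; lra.
Qed.

(** Each power sum is weighted by the inverse of the order of its mean, so that
    one application of Markov's inequality controls all three. *)
Definition sphere_penalty (x : n.-tuple R) : R :=
  n%:R ^+ 2 * (\sum_(i < n) tnth x i ^+ 3) ^+ 2 +
  (n%:R * \sum_(i < n) tnth x i ^+ 4 + n%:R ^+ 3 * \sum_(i < n) tnth x i ^+ 8).

End sphere_integral.

(** * The set of good directions *)

(** The three terms are the bounds $16^{k-1}$ for $n^{k-1}T_k$, $k = 3, 2, 4$,
    where $T_k$ is the mean of $\sum_i x_i^{2k}$. *)
Definition penalty_const {R : realType} : R := 16 ^+ 2 + (16 + 16 ^+ 3).

Lemma penalty_const_ge1 {R : realType} : 1 <= penalty_const :> R.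
Proof.
rewrite /penalty_const; apply: (@le_trans _ _ (0 + (1 + 0))); first by rewrite add0r addr0.
by rewrite !lerD ?exprn_ge0// ler1n.
Qed.

Section good_set.
Context {R : realType} (n : nat) (sigma : probability (n.-tuple R) R).
Hypothesis sigma_unif : is_uniform_on_sphere sigma.
Implicit Types (i j : 'I_n) (x : n.-tuple R).
Local Notation S := (@unit_sphere R n).
Local Notation T k := (sphere_moment sigma k).

Let hadamard4 (a b : R) : ((a + b) ^+ (2 * 2) + (a - b) ^+ (2 * 2)) / 2 ^+ 2 <=
     (a ^+ (2 * 2) + b ^+ (2 * 2)) / 2 +
     8 * (a ^+ (2 * 1) * b ^+ 2 + b ^+ (2 * 1) * a ^+ 2).
Proof.
rewrite -subr_ge0; set lhs := (X in 0 <= X).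
have -> : lhs = 13 * (a * b) ^+ 2 by rewrite /lhs; field.
by rewrite mulr_ge0 ?sqr_ge0.
Qed.

Let hadamard6 (a b : R) : ((a + b) ^+ (2 * 3) + (a - b) ^+ (2 * 3)) / 2 ^+ 3 <=
     (a ^+ (2 * 3) + b ^+ (2 * 3)) / 2 +
     8 * (a ^+ (2 * 2) * b ^+ 2 + b ^+ (2 * 2) * a ^+ 2).
Proof.
rewrite -subr_ge0; set lhs := (X in 0 <= X).
have -> : lhs = (a ^+ 3) ^+ 2 / 4 + (b ^+ 3) ^+ 2 / 4 +
  17 / 4 * ((a ^+ 2 * b) ^+ 2 + (b ^+ 2 * a) ^+ 2) by rewrite /lhs; field.
have := sqr_ge0 (a ^+ 3); have := sqr_ge0 (b ^+ 3).
by have := sqr_ge0 (a ^+ 2 * b); have := sqr_ge0 (b ^+ 2 * a); lra.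
Qed.

Let hadamard8 (a b : R) : ((a + b) ^+ (2 * 4) + (a - b) ^+ (2 * 4)) / 2 ^+ 4 <=
     (a ^+ (2 * 4) + b ^+ (2 * 4)) / 2 +
     8 * (a ^+ (2 * 3) * b ^+ 2 + b ^+ (2 * 3) * a ^+ 2).
Proof.
rewrite -subr_ge0; set lhs := (X in 0 <= X).
have -> : lhs = 3 / 8 * ((a ^+ 4) ^+ 2 + (b ^+ 4) ^+ 2) +
  9 / 2 * (a * b * (a ^+ 2 - b ^+ 2)) ^+ 2 + 1 / 4 * (a ^+ 2 * b ^+ 2) ^+ 2.
  by rewrite /lhs; field.
have := sqr_ge0 (a ^+ 4); have := sqr_ge0 (b ^+ 4).
have := sqr_ge0 (a * b * (a ^+ 2 - b ^+ 2)); have := sqr_ge0 (a ^+ 2 * b ^+ 2); lra.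
Qed.

Let n_ge0 : 0 <= n%:R :> R. Proof. exact: ler0n. Qed.

Let T2 : n%:R * T 2 <= 16.
Proof. by have := sphere_moment_step sigma_unif hadamard4; rewrite sphere_moment1// mulr1. Qed.

Let T3 : n%:R ^+ 2 * T 3 <= 16 ^+ 2.
Proof.
have h := sphere_moment_step sigma_unif hadamard6.
rewrite !expr2 -mulrA; apply: (le_trans (ler_wpM2l n_ge0 h)).
by rewrite mulrCA ler_wpM2l.
Qed.

Let T4 : n%:R ^+ 3 * T 4 <= 16 ^+ 3.
Proof.
have h := sphere_moment_step sigma_unif hadamard8.
rewrite (exprSr n%:R) (exprS 16) -mulrA.
apply: (le_trans (ler_wpM2l (exprn_ge0 2 n_ge0) h)).
by rewrite mulrCA ler_wpM2l.
Qed.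

Let mX k : measurable_fun setT (fun x : n.-tuple R => \sum_(i < n) tnth x i ^+ k).
Proof. by apply: measurable_sum => i; exact: measurable_coordX. Qed.

Let sumX_le k x : S x -> `|\sum_(i < n) tnth x i ^+ k| <= n%:R.
Proof.
move=> Sx; apply: le_trans (ler_norm_sum _ _ _) _.
apply: (@le_trans _ _ (\sum_(i < n) 1)).
  by apply: ler_sum => i _; rewrite normrX exprn_ile1// sphere_coord_le1.
by rewrite sumr_const card_ord.
Qed.

Let iX k : sigma.-integrable S (EFin \o (fun x => \sum_(i < n) tnth x i ^+ k)).
Proof. by apply: (@sphere_integrable _ _ _ _ n%:R) => // x; exact: sumX_le. Qed.

Let iX3 : sigma.-integrable S (EFin \o (fun x => (\sum_(i < n) tnth x i ^+ 3) ^+ 2)).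
Proof.
apply: (@sphere_integrable _ _ _ _ (n%:R ^+ 2)); first exact: measurable_funX.
by move=> x Sx; rewrite normrX ler_pXn2r ?nnegrE// sumX_le.
Qed.

Let E_X k : \int[sigma]_(x in S) (\sum_(i < n) tnth x i ^+ (2 * k)) = T k.
Proof.
have iXi i : sigma.-integrable S (EFin \o (fun x => tnth x i ^+ (2 * k))).
  apply: (@sphere_integrable _ _ _ _ 1); first exact: measurable_coordX.
  by move=> x Sx; rewrite normrX exprn_ile1// sphere_coord_le1.
exact: (Rintegral_sum _ iXi).2.
Qed.

Let mS := @measurable_unit_sphere R n.

Let iP : sigma.-integrable S (EFin \o @sphere_penalty R n).
Proof.
apply: RintegrableD => //; first exact: RintegrableZ.
by apply: RintegrableD => //; exact: RintegrableZ.
Qed.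

Lemma sphere_penalty_mean : \int[sigma]_(x in S) sphere_penalty x <= penalty_const.
Proof.
rewrite /sphere_penalty RintegralD//; [|exact: RintegrableZ|]; last first.
  by apply: RintegrableD => //; exact: RintegrableZ.
rewrite RintegralD//; [|exact: RintegrableZ|exact: RintegrableZ].
rewrite !RintegralZl// (sphere_cube_sum_sqr sigma_unif).
rewrite (E_X 2) (E_X 4).
exact: lerD T3 (lerD T2 T4).
Qed.

Definition good_set (rho : R) : set (n.-tuple R) :=
  S `&` [set x | sphere_penalty x <= penalty_const / rho].

Let mP : measurable_fun setT (@sphere_penalty R n).
Proof.
apply: measurable_funD; first by apply: measurable_funM => //; exact: measurable_funX.
by apply: measurable_funD; exact: measurable_funM.
Qed.

Lemma measurable_good_set (rho : R) : measurable (good_set rho).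
Proof.
apply: measurableI; first exact: mS.
rewrite (_ : [set x | _] = @sphere_penalty R n @^-1` `]-oo, penalty_const / rho]).
  by rewrite -[X in measurable X]setTI; exact: mP.
by apply/seteqP; split => x /=; rewrite in_itv.
Qed.

Lemma good_set_probability (rho : R) : 0 < rho -> ((1 - rho)%:E <= sigma (good_set rho))%E.
Proof.
move=> rho0; have mG := measurable_good_set rho.
pose B := S `\` good_set rho.
have mB : measurable B by apply: measurableD => //; exact: mS.
have c0 : 0 < penalty_const / rho :> R by rewrite divr_gt0// (lt_le_trans ltr01 penalty_const_ge1).
have P0 x : 0 <= sphere_penalty x :> R.
  rewrite /sphere_penalty; apply: addr_ge0; first by rewrite mulr_ge0 ?sqr_ge0.
  have s k : 0 <= \sum_(i < n) tnth x i ^+ (2 * k) :> R.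
    by apply: sumr_ge0 => i _; rewrite exprM exprn_ge0 ?sqr_ge0.
  apply: addr_ge0; apply: mulr_ge0; rewrite ?exprn_ge0//; first exact: (s 2%N).
  exact: (s 4%N).
have sB : sigma B \is a fin_num by exact: fin_num_measure.
have iB : sigma.-integrable S (EFin \o (fun x => penalty_const / rho * \1_B x)).
  apply: RintegrableZ => //; apply: (@sphere_integrable _ _ _ _ 1) => //.
  by move=> x _; rewrite indicE; case: (_ \in _); rewrite ?normr1 ?normr0.
have : \int[sigma]_(x in S) (penalty_const / rho * \1_B x) <=
       \int[sigma]_(x in S) sphere_penalty x.
  apply: le_Rintegral => // x Sx; rewrite indicE; case: (boolP (x \in B)) => [|_]; last by rewrite mulr0.
  rewrite inE => -[_ /not_andP[//|/negP]]; rewrite -ltNge mulr1 => /ltW.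
  exact.
rewrite RintegralZl//; last first.
  apply: (@sphere_integrable _ _ _ _ 1) => //.
  by move=> x _; rewrite indicE; case: (_ \in _); rewrite ?normr1 ?normr0.
rewrite {1}/Rintegral integral_indic// => h.
have BS : B `&` S = B by rewrite setIidl// => x [].
rewrite BS in h.
have sb : fine (sigma B) <= rho.
  have := le_trans h sphere_penalty_mean.
  rewrite -mulrA ger_pMr ?(lt_le_trans ltr01 penalty_const_ge1)//.
  by rewrite mulrC ler_pdivrMr// mul1r.
have SE : sigma S = (sigma (good_set rho) + sigma B)%E.
  rewrite -measureU//.
    by congr (sigma _); rewrite setDUK// => x [].
  by rewrite /B setDE setICA setICr setI0.
rewrite sigma_unif.1 in SE.
have sG : sigma (good_set rho) \is a fin_num by exact: fin_num_measure.
move: SE; rewrite -(fineK sG) -(fineK sB) -EFinD => -[e].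
by rewrite lee_fin; lra.
Qed.

Lemma good_set_sphere (rho : R) : good_set rho `<=` S.
Proof. by move=> x []. Qed.

Lemma good_set_bounds (rho : R) x : 0 < rho -> rho < 1 -> (0 < n)%N -> good_set rho x ->
  [/\ `|\sum_(i < n) tnth x i ^+ 3| <= (penalty_const / rho) / n%:R,
      \sum_(i < n) tnth x i ^+ 4 <= (penalty_const / rho) / n%:R &
      forall i, tnth x i ^+ 8 <= (penalty_const / rho) / n%:R ^+ 3].
Proof.
move=> rho0 rho1 n0 [Sx] /=; set C := penalty_const / rho.
have C1 : 1 <= C by rewrite /C ler_pdivlMr// mul1r (le_trans (ltW rho1))// penalty_const_ge1.
have C0 : 0 <= C := le_trans ler01 C1.
have np : 0 < n%:R :> R by rewrite ltr0n.
rewrite /sphere_penalty.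
set s3 := \sum_(i < n) _ ^+ 3; set s4 := \sum_(i < n) _ ^+ 4; set s8 := \sum_(i < n) _.
have s40 : 0 <= s4 by apply: sumr_ge0 => i _; rewrite (exprM _ 2 2) sqr_ge0.
have s80 : 0 <= s8 by apply: sumr_ge0 => i _; rewrite (exprM _ 4 2) sqr_ge0.
have p3 : 0 <= n%:R ^+ 2 * s3 ^+ 2 by rewrite mulr_ge0 ?sqr_ge0.
have p4 : 0 <= n%:R * s4 by rewrite mulr_ge0.
have p8 : 0 <= n%:R ^+ 3 * s8 by rewrite mulr_ge0 ?exprn_ge0.
move=> h; split.
- rewrite ler_pdivlMr// -(@ler_pXn2r _ 2) ?nnegrE//.
  rewrite exprMn real_normK ?num_real// mulrC; apply: (@le_trans _ _ C); first by lra.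
  by rewrite expr2 ler_peMr.
- by rewrite ler_pdivlMr// mulrC; lra.
- move=> i; rewrite ler_pdivlMr ?exprn_gt0// mulrC.
  have : tnth x i ^+ 8 <= s8.
    rewrite /s8 (bigD1 i)//= lerDl sumr_ge0// => j _.
    by rewrite (exprM _ 4 2) sqr_ge0.
  by move=> /(ler_wpM2l (exprn_ge0 3 (ltW np))); lra.
Qed.

End good_set.

(** * Free convolution at one point of the upper half-plane *)

Section bounded_integral.
Context d (T : measurableType d) {R : realType} (m : {measure set T -> \bar R}).

(** The integral of a nonnegative function is the supremum of the integrals of
    the simple functions below it. *)
Lemma ge0_le_integral_nonmeasurable (D : set T) (f g : T -> \bar R) :
  (forall x, D x -> (0 <= f x)%E) -> (forall x, D x -> (f x <= g x)%E) ->
  (\int[m]_(x in D) f x <= \int[m]_(x in D) g x)%E.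
Proof.
move=> f0 fg; have g0 x : D x -> (0 <= g x)%E.
  by move=> Dx; exact: le_trans (f0 _ Dx) (fg _ Dx).
rewrite !ge0_integralE//; apply: ge_ereal_sup => _ [h hf <-].
apply: ereal_sup_ubound; exists h => // x.
apply: le_trans (hf x) _; rewrite !patchE; case: ifPn => // xD.
by apply: fg; rewrite inE in xD.
Qed.

End bounded_integral.

Section free_convolution.
Context {R : realType} (mu : probability R R).
Hypothesis mu6 : (abs_moment mu 6 < +oo)%E.

Lemma cauchy_transform_dilation (c : R) (w : R[i]) : 0 < Im w ->
  cauchy_transform (dilation c mu) w = resolvent_moment mu w c 0.
Proof.
move=> w0; have [iR iI] := Cintegrable_resolvent mu6 c w0 (leq0n 6).
have mR := measurable_Re_resolvent 1 w0; have mI := measurable_Im_resolvent 1 w0.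
have e (k : R[i] -> R) :
    measurable_fun setT (fun t => k (resolvent w 1 t)) ->
    mu.-integrable setT (EFin \o (fun t => k ((t ^+ 0)%:C * resolvent w c t))) ->
    \int[dilation c mu]_t k (w - t%:C)^-1 = \int[mu]_t k ((t ^+ 0)%:C * resolvent w c t).
  move=> mk ik; rewrite /Rintegral; congr fine.
  rewrite /dilation integral_distribution.
  - by apply: eq_integral => t _ /=; rewrite expr0 mul1r.
  - apply/measurable_EFinP.
    by under [X in measurable_fun _ X]eq_fun do rewrite -[X in w - X%:C]mul1r.
  - by move: ik; apply: eq_integrable => // t _ /=; rewrite expr0 mul1r.
by apply: complex_eqP; apply: e.
Qed.

Lemma moment1_expectation : moment mu 1 = fine 'E_mu[fun x : R => x]%E.
Proof. by rewrite unlock. Qed.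

Lemma moment2_variance : 'E_mu[fun x : R => x]%E = 0%E ->
  moment mu 2 = fine 'V_mu[fun x : R => x]%E.
Proof.
move=> e0; rewrite /variance unlock e0 /= unlock /moment /Rintegral.
congr fine; apply: eq_integral => t _ /=; rewrite expr2.
by rewrite !fctE /= subr0.
Qed.

Hypothesis mean0 : moment mu 1 = 0.
Hypothesis var1 : moment mu 2 = 1.

Local Notation b := (amoment mu).
Local Notation B3 := (expansion_const (b 3) (b 4) (b 5) (b 6)).

(** The subordination equations at the single point $u + iv$ are enough: they
    make $G_\nu$ an approximate root of the quadratic equation that $G_\omega$
    solves exactly. *)
Lemma cauchy_transform_distance n (th : 'I_n -> R) (nu : probability R R)
    (u v eps : R) :
  (0 < n)%N -> is_free_convolution (fun i => dilation (th i) mu) nu ->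
  0 < v -> v <= 1 -> 0 < eps -> eps <= 4 ->
  - 2 + eps / 2 <= u -> u <= 2 - eps / 2 ->
  \sum_(i < n) th i ^+ 2 = 1 ->
  (forall i, th i ^+ 2 <= v / 16) ->
  (forall i, th i ^+ 2 * (2 * b 4 + 1) <= 1 / 2) ->
  normc (cauchy_transform nu (u +i* v) - cauchy_transform semicircle (u +i* v)) <=
  96 * (9 * b 3 * `|\sum_(i < n) th i ^+ 3| + B3 * \sum_(i < n) th i ^+ 4)
  / Num.sqrt eps.
Proof.
move=> n0 [Z [_ ZH _ ZF Zsum]] v0 v1 e0 e4 ulo uhi th2 thv thb.
set z := u +i* v; have z0 : 0 < Im z by [].
pose G := cauchy_transform nu z.
have WG i : resolvent_moment mu (Z i z) (th i) 0 = G.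
  apply: invr_inj; rewrite -/(recip_cauchy nu z) (ZF i z z0) /recip_cauchy.
  by rewrite cauchy_transform_dilation//; exact: ZH.
have Wsum : \sum_(i < n) Z i z - z = n.-1%:R * G^-1.
  by rewrite (Zsum (Ordinal n0) z z0) -(ZF (Ordinal n0) z z0).
have W0 i : 0 < Im (Z i z) by exact: ZH.
have [gz gi] := semicircle_cauchy_transform z0.
apply: (semicircle_stability (erefl z) v0 v1 gz gi (ltW e0) e4 ulo uhi e0).
- exact: (subordination_cauchy_lt0 mu6 mean0 var1 n0 W0 WG).
- exact: (subordination_cauchy_le mu6 mean0 var1 n0 z0 W0 WG Wsum th2 thv thb).
- exact: (approximate_quadratic_equation mu6 mean0 var1 n0 z0 W0 WG Wsum th2 thv thb).
Qed.

End free_convolution.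

Local Open Scope complex_scope.

(** * Rates and constants *)

Section rates.
Context {R : realType}.

(** All the rates are powers of $y = n^{1/4}$: $\varepsilon = y^{-2}$, and $a$ is of
    order $y^{-3}$. *)
Definition root4 (n : nat) : R := n%:R `^ (1 / 4).

Lemma root4_gt0 n : (0 < n)%N -> 0 < root4 n.
Proof. by move=> n0; rewrite powR_gt0// ltr0n. Qed.

Lemma root4_pow4 n : root4 n ^+ 4 = n%:R.
Proof.
rewrite -powR_mulrn ?powR_ge0// /root4 -powRrM.
by rewrite (_ : 1 / 4 * 4%:R = 1) ?powRr1//; field.
Qed.

Lemma powR34_root4 n : n%:R `^ (3 / 4) = root4 n ^+ 3.
Proof.
rewrite -powR_mulrn ?powR_ge0// /root4 -powRrM.
by congr (_ `^ _); field.
Qed.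

Lemma powR32_inv_sqr (y : R) : 0 < y -> ((y ^+ 2)^-1) `^ (3 / 2) = (y ^+ 3)^-1.
Proof.
move=> y0; rewrite -powR_inv1 ?sqr_ge0// -(powR_mulrn 2 (ltW y0)) -!powRrM.
by rewrite -(powR_mulrn 3 (ltW y0)) -powRN; congr (_ `^ _); field.
Qed.

(** $\ln n \ge 1 - 1/n \ge 1/4$. *)
Lemma sqrt_ln_ge_half n : (2 <= n)%N -> 1 / 2 <= Num.sqrt (ln n%:R) :> R.
Proof.
move=> n2; have n2R : 2 <= n%:R :> R by rewrite ler_nat.
have n0 : 0 < n%:R :> R by lra.
have nV : n%:R^-1 <= 1 / 2 :> R by rewrite mul1r lef_pV2 ?posrE.
have nV0 : 0 < n%:R^-1 :> R by rewrite invr_gt0.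
have := @le_ln1Dx R (n%:R^-1 - 1).
rewrite (addrCA 1) subrr addr0 lnV ?posrE// => /(_ ltac:(lra)) h.
have l4 : (1 / 2) ^+ 2 <= ln n%:R :> R by lra.
by rewrite -(@ger0_norm _ (1 / 2)) ?divr_ge0// -sqrtr_sqr ler_wsqrtr.
Qed.

End rates.

Section rate_constant.
Context {R : realType}.

(** Absolute values keep the constants nonnegative for an arbitrary vector
    [beta]; its entries of index 2 to 5 stand for the absolute moments of order 3
    to 6. *)
Definition distance_const (rho : R) (beta : 'I_6 -> R) : R :=
  96 * (9 * `|beta (@Ordinal 6 2 isT)| +
        expansion_const `|beta (@Ordinal 6 2 isT)| `|beta (@Ordinal 6 3 isT)|
                        `|beta (@Ordinal 6 4 isT)| `|beta (@Ordinal 6 5 isT)|)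
  * (penalty_const / rho).

(** The factor 2 pays for $\sqrt{\ln n} \ge 1/2$, and the three terms for the
    integral, $a$ and $\varepsilon^{3/2}$. *)
Definition rate_const (rho : R) (beta : 'I_6 -> R) : R :=
  2 * (distance_const rho beta + 16 * (penalty_const / rho) + 1).

Lemma penalty_ratio_ge1 (rho : R) : 0 < rho -> rho < 1 -> 1 <= penalty_const / rho.
Proof.
by move=> rho0 rho1; rewrite ler_pdivlMr// mul1r (le_trans (ltW rho1))// penalty_const_ge1.
Qed.

Lemma expansion_const_ge0 (b3 b4 b5 b6 : R) :
  0 <= b3 -> 0 <= b4 -> 0 <= b5 -> 0 <= b6 -> 0 <= expansion_const b3 b4 b5 b6.
Proof.
move=> h3 h4 h5 h6; rewrite /expansion_const.
have t0 : 0 <= tail_const b4 b5 b6 by rewrite /tail_const; lra.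
have s0 : 0 <= second_const b3 b4 b5 b6 by rewrite /second_const; lra.
by have := mulr_ge0 h3 s0; lra.
Qed.

Lemma distance_const_ge0 rho beta : 0 < rho -> rho < 1 -> 0 <= distance_const rho beta.
Proof.
move=> rho0 rho1; have c1 := penalty_ratio_ge1 rho0 rho1.
rewrite /distance_const; apply: mulr_ge0; last exact: le_trans ler01 c1.
by rewrite mulr_ge0// addr_ge0 ?mulr_ge0// expansion_const_ge0.
Qed.

Lemma rate_const_gt0 rho beta : 0 < rho -> rho < 1 -> 0 < rate_const rho beta.
Proof.
move=> rho0 rho1; have c1 := penalty_ratio_ge1 rho0 rho1.
by rewrite /rate_const; have := distance_const_ge0 beta rho0 rho1; lra.
Qed.

End rate_constant.

Theorem theorem1p4 (R : realType)
  (sigma : forall n : nat, probability (n.-tuple R) R)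
  (sigma_unif : forall n : nat, (0 < n)%N -> is_uniform_on_sphere (sigma n))
  (rho : R) (rho0 : 0 < rho) (rho1 : rho < 1) :
  exists C : ('I_6 -> R) -> R,
    (forall beta : 'I_6 -> R, 0 < C beta) /\
    forall mu : probability R R,
      'E_mu[fun x : R => x]%E = 0%E ->
      'V_mu[fun x : R => x]%E = 1%E ->
      (abs_moment mu 6 < +oo)%E ->
      exists (n0 : nat) (a eps : nat -> R) (F : forall n : nat, set (n.-tuple R)),
        [/\ (forall n : nat, (n0 <= n)%N ->
               [/\ 0 < a n, a n < 1, 0 <= eps n & eps n <= 4]),
            (forall n : nat, (0 < n)%N ->
               [/\ measurable (F n),
                   F n `<=` unit_sphere n &
                   ((1 - rho)%:E <= sigma n (F n))%E]) &
            (forall (n : nat) (theta : n.-tuple R) (mu_theta : probability R R),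
               (0 < n)%N -> (n0 <= n)%N -> F n theta ->
               is_free_convolution
                 (fun i : 'I_n => dilation (tnth theta i) mu) mu_theta ->
               (Delta_tilde (a n) (eps n) mu_theta semicircle
                <= (C (fun k : 'I_6 => fine (abs_moment mu k.+1))
                    * (Num.sqrt (ln n%:R) / n%:R `^ (3 / 4)))%:E)%E)].
Proof.
exists (rate_const rho); split; first by move=> beta; exact: rate_const_gt0.
move=> mu mean var mu6.
have mean0 : moment mu 1 = 0 by rewrite moment1_expectation mean.
have var1 : moment mu 2 = 1 by rewrite moment2_variance// var.
pose b := amoment mu; pose C1 : R := penalty_const / rho.
have C1ge : 1 <= C1 := penalty_ratio_ge1 rho0 rho1.
have b4 : 0 <= b 4%N := amoment_ge0 mu 4.
(* n^(1/4) > Y gives a n < 1 and th_i^2 (2 b_4 + 1) <= 1/2 *)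
pose Y : R := 1 + 16 * C1 + 2 * C1 * (2 * b 4%N + 1).
have Cb : 0 <= C1 * b 4%N by rewrite mulr_ge0// (le_trans ler01 C1ge).
have Y1 : 1 <= Y by rewrite /Y; lra.
pose n0 := (Num.bound (Y ^+ 4) + 2)%N.
have large n : (n0 <= n)%N -> [/\ (2 <= n)%N, (0 < n)%N & Y < root4 n].
  move=> n0n; have n2 : (2 <= n)%N by apply: leq_trans n0n; rewrite leq_addl.
  have np : (0 < n)%N by exact: leq_trans n2.
  have y0 := ltW (@root4_gt0 R n np); have Y0 : 0 <= Y := le_trans ler01 Y1.
  split => //; rewrite -(@ltr_pXn2r _ 4) ?nnegrE// root4_pow4.
  apply: lt_le_trans (archi_boundP (exprn_ge0 4 (le_trans ler01 Y1))) _.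
  by rewrite ler_nat (leq_trans _ n0n)// leq_addr.
(* on the good set th_i^2 <= C1 / n^(3/4), which is at most v / 16 for v >= a n *)
pose a n : R := 16 * C1 / root4 n ^+ 3.
(* sqrt (eps n) = n^(-1/4) divides the O(1/n) error of the quadratic equation *)
pose eps n : R := (root4 n ^+ 2)^-1.
have y3 n : (n0 <= n)%N -> Y < root4 n ^+ 3.
  move=> /large[_ _ Yy]; apply: (lt_le_trans Yy).
  have y1 : 1 <= root4 n := le_trans Y1 (ltW Yy).
  exact: ler_eXnr.
exists n0, a, eps, (fun n => good_set rho); split.
- move=> n n0n; have [n2 np Yy] := large n n0n; have Yy3 := y3 n n0n.
  have yp := @root4_gt0 R n np.
  have yp3 : 0 < root4 n ^+ 3 :> R by rewrite exprn_gt0.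
  split.
  + by rewrite /a divr_gt0// mulr_gt0// (lt_le_trans ltr01).
  + rewrite /a ltr_pdivrMr// mul1r; apply: lt_trans Yy3.
    by rewrite /Y; lra.
  + by rewrite /eps invr_ge0 sqr_ge0.
  + have : (root4 n ^+ 2)^-1 <= 1 :> R.
      by rewrite invf_le1 ?exprn_gt0// exprn_ege1// ltW// (le_lt_trans Y1).
    by rewrite /eps; lra.
- move=> n np; split; [exact: measurable_good_set|exact: good_set_sphere|].
  by have := good_set_probability (sigma_unif n np) rho0.
move=> n theta nu np n0n Fth conv.
have [n2 _ Yy] := large n n0n; have Yy3 := y3 n n0n.
have [th3 th4 th8] := good_set_bounds rho0 rho1 np Fth.
have th2 := good_set_sphere Fth.
set y : R := root4 n in Yy Yy3.
have yp : 0 < y by exact: root4_gt0.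
have yp3 : 0 < y ^+ 3 by rewrite exprn_gt0.
have nE : n%:R = y ^+ 4 by rewrite root4_pow4.
have thmax i : tnth theta i ^+ 2 <= C1 / y ^+ 3.
  have C0 := le_trans ler01 C1ge.
  have Cy : 0 <= C1 / y ^+ 3 := divr_ge0 C0 (ltW yp3).
  rewrite -(@ler_pXn2r _ 4) ?nnegrE ?sqr_ge0//.
  have yE : (y ^+ 3) ^+ 4 = n%:R ^+ 3 by rewrite nE -!exprM mulnC.
  rewrite -exprM expr_div_n yE.
  apply: le_trans (th8 i) _; rewrite ler_wpM2r ?invr_ge0 ?exprn_ge0//.
  by rewrite -/C1 exprS ler_peMr// exprn_ege1.
pose beta (k : 'I_6) := fine (abs_moment mu k.+1).
rewrite -/beta.
have betaE (k : 'I_6) : `|beta k| = b k.+1.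
  by rewrite ger0_norm//; exact: amoment_ge0.
pose D := distance_const rho beta / y ^+ 3.
have D0 : 0 <= D by rewrite divr_ge0 ?(ltW yp3)// distance_const_ge0.
have sup_le : (ereal_sup
     [set \int[lebesgue_measure]_(v in `[a n, 1%R])
            (normc (cauchy_transform nu (u +i* v)
                          - cauchy_transform semicircle (u +i* v)))%:E
     | u in `[(- 2 + eps n / 2)%R, (2 - eps n / 2)%R]] <= D%:E)%E.
  apply: ge_ereal_sup => _ [u uI <-].
  have /andP[ulo uhi] : (- 2 + eps n / 2 <= u) && (u <= 2 - eps n / 2).
    by move: uI; rewrite /= in_itv.
  have eps0 : 0 < eps n by rewrite invr_gt0 exprn_gt0.
  have eps4 : eps n <= 4.
    have : (y ^+ 2)^-1 <= 1.
      by rewrite invf_le1 ?exprn_gt0// exprn_ege1// ltW// (le_lt_trans Y1).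
    by rewrite /eps -/y; lra.
  have sqrt_eps : Num.sqrt (eps n) = y^-1.
    by rewrite /eps -exprVn sqrtr_sqr ger0_norm// invr_ge0 ltW.
  have pointwise v : v \in `[a n, 1%R] ->
      normc (cauchy_transform nu (u +i* v) - cauchy_transform semicircle (u +i* v)) <= D.
    rewrite in_itv /= => /andP[av v1].
    have v0 : 0 < v.
      by apply: lt_le_trans av; rewrite /a divr_gt0// mulr_gt0// (lt_le_trans ltr01).
    have thv i : tnth theta i ^+ 2 <= v / 16.
      apply: le_trans (thmax i) _; rewrite ler_pdivlMr// mulrC mulrA.
      exact: av.
    have thb i : tnth theta i ^+ 2 * (2 * b 4%N + 1) <= 1 / 2.
      apply: (@le_trans _ _ (C1 / y ^+ 3 * (2 * b 4%N + 1))).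
        by rewrite ler_wpM2r//; lra.
      rewrite mulrAC ler_pdivrMr//; apply: le_trans (_ : 1 / 2 * Y <= _); last first.
        by rewrite ler_pM2l ?ltW//; lra.
      by rewrite /Y; lra.
    have := cauchy_transform_distance mu6 mean0 var1 np conv v0 v1 eps0 eps4
      ulo uhi th2 thv thb.
    move=> h; apply: le_trans h _.
    rewrite sqrt_eps invrK /D /distance_const !betaE /=.
    set B3 := expansion_const _ _ _ _.
    have B30 : 0 <= B3 by rewrite expansion_const_ge0 ?amoment_ge0.
    have b30 : 0 <= b 3%N := amoment_ge0 mu 3.
    have -> : 96 * (9 * b 3%N + B3) * (penalty_const / rho) / y ^+ 3 =
        96 * (9 * b 3%N * (C1 / n%:R) + B3 * (C1 / n%:R)) * y.
      by rewrite nE -/C1; field; rewrite gt_eqF.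
    rewrite ler_wpM2r ?(ltW yp)// ler_wpM2l// lerD// ler_wpM2l// mulr_ge0//.
  apply: (@le_trans _ _ (\int[lebesgue_measure]_(v in `[a n, 1%R]) (cst D%:E) v)%E).
    apply: ge0_le_integral_nonmeasurable => v vI.
      by rewrite lee_fin normc_ge0.
    by rewrite lee_fin pointwise.
  rewrite integral_cst//= lebesgue_measure_itv/= lte_fin.
  case: ifPn => [_|_]; last by rewrite mule0 lee_fin.
  rewrite -EFinB -EFinM lee_fin ler_piMr// gerBl.
  by rewrite /a divr_ge0 ?(ltW yp3)// mulr_ge0// (le_trans ler01).
rewrite /Delta_tilde powR32_inv_sqr//.
apply: (@le_trans _ _ (D%:E + (a n)%:E + ((y ^+ 3)^-1)%:E)%E).
  by rewrite leeD// leeD.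
rewrite -!EFinD lee_fin powR34_root4 -/y /D /a -/y /rate_const.
have sl : 1 / 2 <= Num.sqrt (ln n%:R) :> R := sqrt_ln_ge_half n2.
have M0 := rate_const_gt0 beta rho0 rho1; rewrite /rate_const in M0.
have -> : distance_const rho beta / y ^+ 3 + 16 * C1 / y ^+ 3 + (y ^+ 3)^-1 =
  2 * (distance_const rho beta + 16 * C1 + 1) * ((1 / 2) / y ^+ 3).
  by field; rewrite gt_eqF.
by rewrite ler_pM2l// ler_pM2r// invr_gt0.
Qed.
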